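(* Let $M$ be a complete hyperbolic complex manifold with Kobayashi distance $k_M$, and let $H$ be a holomorphic vector field on $M$. Then the following are equivalent: (a) there exist $\varepsilon>0$ and a family of holomorphic mappings $(f_t\colon M\to M)_{t\in[0,\varepsilon)}$ such that for every $z\in M$ one has $f_0(z)=z$ and $$\frac{\partial}{\partial t} f_t(z)\Big|_{t=0}=\lim_{t\to 0^+}\frac{f_t(z)-z}{t}=H(z);$$ (b) for every $z,w\in M$ with $z\neq w$ one has $$(dk_M)_{(z,w)}(H(z),H(w))\leq 0;$$ (c) $H$ is an infinitesimal generator.
   Context: Complex manifolds are connected. $k_M\colon M\times M\to[0,+\infty)$ denotes the Kobayashi pseudodistance of $M$; $M$ is complete hyperbolic if $k_M$ is a distance and $(M,k_M)$ is a complete metric space. A holomorphic vector field $H$ on $M$ is an infinitesimal generator if for every $z_0\in M$ the Cauchy problem $\dot z(t)=H(z(t))$, $z(0)=z_0$, has a solution $z\colon[0,+\infty)\to M$. The difference quotient in (a) is understood in a local holomorphic chart around $z$ (i.e. $t\mapsto f_t(z)$ has right derivative $H(z)$ at $t=0$). Dini derivative: for a locally Lipschitz function $f\colon\Omega\to\mathbb{R}$ on a domain $\Omega\subset\mathbb{R}^N$, $x\in\Omega$ and $v\in\mathbb{R}^N$, set $$df_x(v):=\liminf_{h\to0^+}\frac{f(x+hv)-f(x)}{h}.$$ On a manifold, $df_x(v)$ is defined for a tangent vector $v$ at $x$ by this formula in any chart (the value does not depend on the chart). The function $k_M$ is locally Lipschitz on $M\times M$ (in charts), and $(dk_M)_{(z,w)}(u,v)$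 is the directional Dini derivative of $k_M$ at the point $(z,w)\in M\times M$ in the direction $(u,v)\in T_zM\times T_wM$. *)

(* Defs.v *)
From HB Require Import structures.
From mathcomp Require Export all_boot all_order all_algebra.
From mathcomp Require Export all_classical all_reals all_analysis.
From mathcomp Require Export complex.

Set Implicit Arguments.
Unset Strict Implicit.
Unset Printing Implicit Defensive.

Export Order.TTheory GRing.Theory Num.Theory.
Export numFieldNormedType.Exports.

#[global] Open Scope classical_set_scope.
#[global] Open Scope ring_scope.

(* R[i] is normed over itself; the library declares this for an abstract
   numFieldType only.                                                        *)
HB.instance Definition _ (R : realType) := NormedModule.copy R[i] R[i]^o.

(* [chart_map] and [chart_inv] are total functions; only their values on
   [chart_dom] and on [chart_map @` chart_dom] respectively are meaningful.  *)
Record chart (R : realType) (n : nat) (T : topologicalType) := Chart {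
  chart_dom : set T;
  chart_map :> T -> 'rV[R[i]]_n;
  chart_inv : 'rV[R[i]]_n -> T;
  chart_dom_open : open chart_dom;
  chart_im_open : open (chart_map @` chart_dom);
  chart_mapK : forall z, chart_dom z -> chart_inv (chart_map z) = z;
  chart_map_cont : forall z, chart_dom z -> {for z, continuous chart_map};
  chart_inv_cont :
    forall z, chart_dom z -> {for chart_map z, continuous chart_inv}
}.

(* Differentiability is taken over the field R[i], so the transition maps,
   which are defined near every point of an open set, are holomorphic.       *)
Record complexManifold (R : realType) (n : nat) := ComplexManifold {
  mcarrier :> topologicalType;
  atlas : set (chart R n mcarrier);
  mhausdorff : hausdorff_space mcarrier;
  msecond_countable : @second_countable mcarrier;
  mconnected : connected [set: mcarrier];
  atlas_cover : forall z, exists2 c, atlas c & chart_dom c z;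
  atlas_compat : forall c d z, atlas c -> atlas d ->
    chart_dom c z -> chart_dom d z ->
    differentiable (d \o chart_inv c) (c z)
}.

Definition chart_at (R : realType) (n : nat) (M : complexManifold R n)
  (z : M) : set (chart R n M) := [set c | atlas c /\ chart_dom c z].

(* Complex differentiability at a point of a map from a normed space to M.   *)
Definition cdiff_at (R : realType) (n : nat) (M : complexManifold R n)
    (V : normedModType R[i]) (f : V -> M) (a : V) : Prop :=
  {for a, continuous f} /\
  forall c, chart_at (f a) c -> differentiable (c \o f) a.

Definition holomorphic (R : realType) (m n : nat) (M : complexManifold R m)
    (N : complexManifold R n) (f : M -> N) : Prop :=
  forall (z : M) c, chart_at z c -> cdiff_at (f \o chart_inv c) (c z).

Definition unit_disc (R : realType) : set R[i] := [set a | `|a| < 1].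

Definition holomorphic_disc (R : realType) (n : nat)
    (M : complexManifold R n) (f : R[i] -> M) : Prop :=
  forall a, unit_disc a -> cdiff_at f a.

(* The Poincare distance of the unit disc, with curvature -4.                *)
Definition poincare (R : realType) (a b : R[i]) : R :=
  let r := complex.Re `|(a - b) / (1 - conjc b * a)| in
  2^-1 * ln ((1 + r) / (1 - r)).

(* [s] is the length of a chain of holomorphic discs from [z] to [w]: the
   [j]-th disc sends [a j] to [p j] and [b j] to [p j.+1].                   *)
Definition disc_chain (R : realType) (n : nat) (M : complexManifold R n)
    (z w : M) (s : R) : Prop :=
  exists (m : nat) (p : nat -> M) (f : nat -> R[i] -> M)
         (a b : nat -> R[i]),
    [/\ (0 < m)%N, p 0%N = z, p m = w,
        (forall j, (j < m)%N ->
           [/\ holomorphic_disc (f j), unit_disc (a j), unit_disc (b j),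
               f j (a j) = p j & f j (b j) = p j.+1])
      & s = \sum_(j < m) poincare (a j) (b j)].

(* Chains exist between any two points since M is connected, so the infimum
   is over a nonempty set of nonnegative reals.                              *)
Definition kobayashi (R : realType) (n : nat) (M : complexManifold R n)
    (z w : M) : R := inf [set s | disc_chain z w s].

Definition is_distance (R : realType) (T : Type) (d : T -> T -> R) : Prop :=
  [/\ forall x y, 0 <= d x y,
      forall x y, d x y = 0 <-> x = y,
      forall x y, d x y = d y x
    & forall x y z, d x z <= d x y + d y z].

Definition is_complete (R : realType) (T : Type) (d : T -> T -> R) : Prop :=
  forall u : nat -> T,
    (forall e : R, 0 < e -> exists N : nat, forall i j : nat,
       (N <= i)%N -> (N <= j)%N -> d (u i) (u j) < e) ->
    exists l : T, (fun i => d (u i) l) @ \oo --> (0 : R).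

Definition complete_hyperbolic (R : realType) (n : nat)
    (M : complexManifold R n) : Prop :=
  is_distance (@kobayashi R n M) /\ is_complete (@kobayashi R n M).

(* A tangent vector at z is given by its coordinates in every chart at z,
   which change by the differential of the transition maps.  The values on
   other charts are irrelevant.                                              *)
Record tangent (R : realType) (n : nat) (M : complexManifold R n) (z : M) :=
  Tangent {
    tcoord :> chart R n M -> 'rV[R[i]]_n;
    tcoord_change : forall c d, chart_at z c -> chart_at z d ->
      tcoord d = 'd (d \o chart_inv c) (c z) (tcoord c)
  }.

Definition holomorphic_vector_field (R : realType) (n : nat)
    (M : complexManifold R n) (H : forall z : M, tangent z) : Prop :=
  forall (z : M) c, chart_at z c ->
    differentiable (fun x => H (chart_inv c x) c) (c z).

(* The curve [g], considered on the set of times [A], tends to [z] at time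
   [t] and has there the derivative [v], computed in charts around [z].      *)
Definition derivative_within (R : realType) (n : nat)
    (M : complexManifold R n) (A : set R) (g : R -> M) (t : R)
    (z : M) (v : tangent z) : Prop :=
  g s @[s --> within A t^'] --> z /\
  forall c, chart_at z c ->
    ((s - t)^-1)%:C%C *: (c (g s) - c z) @[s --> within A t^'] --> v c.

Definition infinitesimal_generator (R : realType) (n : nat)
    (M : complexManifold R n) (H : forall z : M, tangent z) : Prop :=
  forall z0 : M, exists g : R -> M, g 0 = z0 /\
    forall t, 0 <= t -> derivative_within [set s | 0 <= s] g t (H (g t)).

(* The lower limit is taken in the extended reals; it is finite when [f] is
   locally Lipschitz.                                                        *)
Definition dini (R : realType) (V : lmodType R[i]) (f : V -> R) (x v : V)
    : \bar R :=
  limf_einf (fun h : R => ((f (x + h%:C%C *: v) - f x) / h)%:E) 0^'+.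

Definition dini_in_charts (R : realType) (n : nat) (M : complexManifold R n)
    (k : M -> M -> R) (z w : M) (c d : chart R n M)
    (u : tangent z) (v : tangent w) : \bar R :=
  dini (fun x : 'rV[R[i]]_n * 'rV[R[i]]_n =>
          k (chart_inv c x.1) (chart_inv d x.2))
       (c z, d w) (u c, v d).

(* Main.v *)
From HB Require Import structures.
Require Import Defs.
From mathcomp Require Import ring lra.

(* (a) implies (b) because holomorphic maps do not increase the Kobayashi
   distance k, which is Lipschitz in charts, so that f_t(z) can be replaced by
   z + t H(z) in the difference quotients.

   (b) implies that k(z(t), w(t)) is nonincreasing for any two integral curves
   of H.  Applied to z(t) and z(t + s), this makes a maximal integral curve a
   Cauchy curve at its final time; by completeness it has a limit, and it can
   be continued past it because k induces the topology of M.

   For (c) implies (a) one takes the flow of H, holomorphic because this can be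
   checked on short times.

   Local Lipschitz and Taylor estimates for holomorphic maps are derived from
   the hyperbolicity of M instead of the Cauchy integral formula.  A bounded
   holomorphic map F between balls of C^n can be scaled into a chart of M, and
   its discs are then contracted by k; as k separates the points of a compact
   part of the chart, the oscillation of F on a small concentric ball is at
   most a quarter of its bound.  With D_h F(x) = F(x + h) - F(x), the identity
   2 D_h F = D_2h F - D_h D_h F improves this to a Lipschitz estimate, and the
   estimate for D_h F bounds the second differences.                          *)

Set Implicit Arguments.
Unset Strict Implicit.
Unset Printing Implicit Defensive.

(** Hyperbolicity enters the local estimates only as positivity of k off the diagonal, made uniform
    on a compact part of one chart. The resulting oscillation bound has the same constants for all
    maps, centres and radii, so it applies again to D_h F on a ball of half the radius. A factor a
    then becomes a(1 + a)/2. This has the fixed point 1, so the first bound must lie strictly below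
    1; from 1/4 on the factors decay like the radius, and that is a Lipschitz bound.

    The flow is differentiated without a variational equation: Gronwall's inequality shows that its
    increments are linear over the complex scalars up to a quadratic error, and rescaling extracts
    the derivative.

    Condition (b) has two weaknesses. It is a lower limit, so that only arbitrarily small time
    steps, not all small ones, are controlled; the comparison principle for real functions is shaped
    accordingly. And it is silent for z = w, which is met by truncating k from below by a positive
    constant. *)

Local Notation "t %:C" := (real_complex _ t) : ring_scope.

(** * Real-valued norms and differentials *)

(* The norm of a normed module over R[i] has its values in R[i]. *)
Definition nm (R : realType) (V : normedModType R[i]) (x : V) : R :=
  complex.Re `|x|.

Section Norm.
Variable R : realType.
Implicit Types (V W : normedModType R[i]).

Lemma nmE V (x : V) : `|x| = (nm x)%:C.
Proof. by rewrite /nm RRe_real // ger0_real. Qed.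

Lemma nm_ge0 V (x : V) : 0 <= nm x.
Proof. by rewrite -ler0c -nmE normr_ge0. Qed.

Lemma nm0 V : nm (0 : V) = 0.
Proof. by rewrite /nm normr0. Qed.

Lemma nm_eq0 V (x : V) : nm x = 0 -> x = 0.
Proof. by move=> x0; apply/eqP; rewrite -normr_eq0 nmE x0. Qed.

Lemma nm_gt0 V (x : V) : (0 < nm x) = (x != 0).
Proof.
rewrite lt_neqAle nm_ge0 andbT eq_sym; congr (~~ _).
by apply/eqP/eqP => [/nm_eq0|->]; rewrite ?nm0.
Qed.

Lemma nmD V (x y : V) : nm (x + y) <= nm x + nm y.
Proof. by rewrite -lecR rmorphD /= -!nmE ler_normD. Qed.

Lemma nmN V (x : V) : nm (- x) = nm x.
Proof. by rewrite /nm normrN. Qed.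

Lemma nmBC V (x y : V) : nm (x - y) = nm (y - x).
Proof. by rewrite -nmN opprB. Qed.

Lemma nmB V (x y : V) : nm (x - y) <= nm x + nm y.
Proof. by rewrite -(nmN y) nmD. Qed.

Lemma nmDB V (x y z : V) : nm (x - z) <= nm (x - y) + nm (y - z).
Proof. by rewrite -(subrKA y) nmD. Qed.

Lemma nmB_le V (x y : V) : nm x - nm y <= nm (x - y).
Proof. by rewrite lerBlDr -{1}(subrK y x) nmD. Qed.

Lemma nmZ V (a : R[i]) (x : V) : nm (a *: x) = nm a * nm x.
Proof.
by apply: complexI; rewrite rmorphM /= -!nmE normrZ.
Qed.

Lemma nm_real (t : R) : nm (t%:C : R[i]) = `|t|.
Proof. by rewrite /nm normc_def /= expr0n addr0 sqrtr_sqr. Qed.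

Lemma nmZr V (t : R) (x : V) : nm (t%:C *: x) = `|t| * nm x.
Proof. by rewrite nmZ nm_real. Qed.

Lemma nbhs_nm V (x : V) (A : set V) :
  nbhs x A <-> exists2 r : R, 0 < r & forall y, nm (y - x) < r -> A y.
Proof.
split=> [/nbhs_normP[r /= r0 rA]|[r r0 rA]].
  have rE : r = (complex.Re r)%:C by rewrite RRe_real // gtr0_real.
  exists (complex.Re r); first by rewrite -ltcR -rE.
  by move=> y yr; apply: rA => /=; rewrite distrC nmE rE ltcR.
apply/nbhs_normP; exists r%:C => /=; first by rewrite ltcR.
by move=> y /=; rewrite distrC nmE ltcR; apply: rA.
Qed.

Lemma cvg_nm V W (f : V -> W) (x : V) (l : W) : (f @ x --> l) <->
  forall e : R, 0 < e -> exists2 d : R, 0 < d &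
    forall y, nm (y - x) < d -> nm (f y - l) < e.
Proof.
split=> [fl e e0|fl A /nbhs_nm[e e0 eA]].
  have /nbhs_nm[d d0 dP] : nbhs x (f @^-1` [set z | nm (z - l) < e]).
    by apply: fl; apply/nbhs_nm; exists e.
  by exists d.
have [d d0 dP] := fl _ e0.
by apply/nbhs_nm; exists d => // y /dP /eA.
Qed.

Lemma nbhs_real (t : R) (A : set R) :
  nbhs t A <-> exists2 r : R, 0 < r & forall s, `|s - t| < r -> A s.
Proof.
split=> [/nbhs_normP[r /= r0 rA]|[r r0 rA]].
  by exists r => // s str; apply: rA => /=; rewrite distrC.
by apply/nbhs_normP; exists r => //= s /=; rewrite distrC; apply: rA.
Qed.

Lemma diff_nm V W (f : V -> W) (x : V) : differentiable f x ->
  forall e : R, 0 < e -> exists2 d : R, 0 < d &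
    forall h, nm h < d -> nm (f (x + h) - f x - 'd f x h) <= e * nm h.
Proof.
move=> /diff_locally /eqaddoP /= fo e e0.
have /nbhs_nm[d d0 dP] := fo e%:C ltac:(by rewrite ltcR).
exists d => // h hd; have := dP h.
rewrite subr0 => /(_ hd) /=; rewrite !nmE -rmorphM lecR.
by rewrite !fctE /= [h + x]addrC opprD addrA.
Qed.

Lemma diff_bounded V W (f : V -> W) (x : V) : differentiable f x ->
  exists2 C : R, 0 < C & forall h, nm ('d f x h) <= C * nm h.
Proof.
move=> /diff_continuous /(_ 0) /cvg_nm fc.
have [d d0 dP] := fc 1 ltr01.
exists (2 / d) => [|h]; first by rewrite divr_gt0.
have [->|h0] := eqVneq h 0; first by rewrite linear0 !nm0 mulr0.
have nh : 0 < nm h by rewrite nm_gt0.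
have q0 : 0 < d / (2 * nm h) by rewrite divr_gt0 // mulr_gt0.
have := dP ((d / (2 * nm h))%:C *: h); rewrite (linear0 ('d f x)) !subr0 linearZ /= !nmZr.
rewrite (gtr0_norm q0).
have -> : d / (2 * nm h) * nm h = d / 2 by field; rewrite gt_eqF.
move=> /(_ ltac:(lra)) /ltW le1.
have -> : 2 / d * nm h = 1 / (d / (2 * nm h)) by field; rewrite !gt_eqF.
by rewrite ler_pdivlMr ?divr_gt0 ?mulr_gt0 // mulrC.
Qed.

(** The bound makes the linear map continuous, and a continuous linear map with a remainder of order
    o(h) is the differential, by uniqueness. *)
Lemma diff_of_nm V W (f : V -> W) (x : V) (L : V -> W) (C : R) :
  linear L -> (forall h, nm (L h) <= C * nm h) ->
  (forall e : R, 0 < e -> exists2 d : R, 0 < d &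
    forall h, nm h < d -> nm (f (x + h) - f x - L h) <= e * nm h) ->
  differentiable f x /\ 'd f x = L :> (V -> W).
Proof.
move=> Ll LC fL.
pose L' : {linear V -> W} := HB.pack L (GRing.isLinear.Build _ _ _ _ L Ll).
have Lc : continuous L'.
  move=> y; apply/cvg_nm => e e0.
  exists (e / (`|C| + 1)) => [|z zd]; first by rewrite divr_gt0 // ltr_wpDl.
  rewrite -linearB; apply: le_lt_trans (LC _) _.
  apply: le_lt_trans (_ : (`|C| + 1) * nm (z - y) < _).
    by rewrite ler_wpM2r ?nm_ge0 //; have := ler_norm C; lra.
  by rewrite mulrC -ltr_pdivlMr // ltr_wpDl.
have fo : f \o shift x = cst (f x) + L' +o_ 0 id.
  apply/eqaddoP => eps /= eps0.
  have epsE : eps = (complex.Re eps)%:C by rewrite RRe_real // gtr0_real.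
  have [|d d0 dP] := fL (complex.Re eps); first by rewrite -ltcR -epsE.
  apply/nbhs_nm; exists d => // h; rewrite subr0 => /dP.
  rewrite !nmE epsE -rmorphM lecR !fctE /= [h + x]addrC.
  by rewrite opprD addrA.
have dL := diff_unique Lc fo.
by split=> //; apply/diff_locallyP; rewrite dL.
Qed.

End Norm.

(** * The Poincare distance of the unit disc *)

Section Poincare.
Variable R : realType.
Implicit Types (a b z : R[i]).

Lemma nm_sqr z : nm z ^+ 2 = complex.Re z ^+ 2 + complex.Im z ^+ 2.
Proof. by rewrite /nm normc_def /= sqr_sqrtr // addr_ge0 // sqr_ge0. Qed.

Lemma unit_discE a : unit_disc a = (nm a < 1) :> Prop.
Proof. by rewrite /unit_disc /= nmE -ltcR. Qed.

Lemma nm_M a b : nm (a * b) = nm a * nm b.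
Proof. exact: (nmZ (V := R[i]) a b). Qed.

Lemma nm_div a b : nm (a / b) = nm a / nm b.
Proof. by apply: complexI; rewrite rmorphM fmorphV /= -!nmE normrM normfV. Qed.

Let pr a b : R := nm ((a - b) / (1 - conjc b * a)).

Lemma poincareE a b : poincare a b = 2^-1 * ln ((1 + pr a b) / (1 - pr a b)).
Proof. by []. Qed.

(** With [A] and [B] the squared moduli of [a] and [b], the squares of the two sides differ by
    [(1 - A) * (1 - B)]. *)
Lemma pseudo_ltr a b : nm a < 1 -> nm b < 1 -> nm (a - b) < nm (1 - conjc b * a).
Proof.
move=> a1 b1; rewrite -(ltr_pXn2r (n := 2)) ?nnegrE ?nm_ge0 // !nm_sqr.
have : nm a ^+ 2 < 1 by rewrite expr_lt1 // nm_ge0.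
have : nm b ^+ 2 < 1 by rewrite expr_lt1 // nm_ge0.
rewrite !nm_sqr; case: a b a1 b1 => [a1 a2] [b1 b2] _ _ /=.
set A := a1 ^+ 2 + _; set B := b1 ^+ 2 + _ => B1 A1.
have : 0 < (1 - A) * (1 - B) by rewrite mulr_gt0 // subr_gt0.
rewrite -subr_gt0 /A /B; congr (0 < _); ring.
Qed.

Lemma pr_ge0 a b : 0 <= pr a b. Proof. exact: nm_ge0. Qed.

Lemma pr_lt1 a b : nm a < 1 -> nm b < 1 -> pr a b < 1.
Proof.
move=> a1 b1; have h := pseudo_ltr a1 b1.
by rewrite /pr nm_div ltr_pdivrMr ?mul1r // (le_lt_trans _ h) // nm_ge0.
Qed.

Lemma atanh_le (r s : R) : 0 <= r -> r <= s -> s < 1 ->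
  2^-1 * ln ((1 + r) / (1 - r)) <= 2^-1 * ln ((1 + s) / (1 - s)).
Proof.
move=> r0 rs s1; have r1 : 0 < 1 - r by lra.
have s1' : 0 < 1 - s by lra.
rewrite ler_wpM2l // ler_ln ?posrE ?divr_gt0 //; try lra.
rewrite (ler_pdivrMr _ _ r1) mulrAC (ler_pdivlMr _ _ s1').
have -> : (1 + s) * (1 - r) = (1 + r) * (1 - s) + 2 * (s - r) by ring.
by rewrite lerDl mulr_ge0 // subr_ge0.
Qed.

Lemma poincare_ge0 a b : nm a < 1 -> nm b < 1 -> 0 <= poincare a b.
Proof.
move=> a1 b1; rewrite poincareE; apply: le_trans (atanh_le _ (pr_ge0 a b) (pr_lt1 a1 b1)) => //.
by rewrite subr0 addr0 divr1 ln1 mulr0.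
Qed.

(** Traversing a disc of a chain along a straight segment must not cost more than the disc itself;
    this makes chains usable as continuous paths. By monotonicity of artanh it is enough to compare
    pseudohyperbolic distances. *)
Lemma poincare_segment a b (t : R) : nm a < 1 -> nm b < 1 -> 0 <= t <= 1 ->
  nm (a + t%:C * (b - a)) < 1 /\
  poincare a (a + t%:C * (b - a)) <= poincare a b.
Proof.
move=> a1 b1 /andP[t0 t1]; set x := a + _.
have x1 : nm x < 1.
  have u0 : 0 <= 1 - t by rewrite subr_ge0.
  have -> : x = (1 - t)%:C * a + t%:C * b by rewrite /x rmorphB rmorph1; ring.
  apply: le_lt_trans (nmD _ _) _; rewrite !nm_M !nm_real !ger0_norm //.
  have h1 : 0 <= (1 - t) * (1 - nm a) by rewrite mulr_ge0 // subr_ge0 ltW.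
  have [t00|tn0] := eqVneq t 0; first by rewrite t00; lra.
  have h2 : 0 < t * (1 - nm b) by rewrite mulr_gt0 ?subr_gt0 // lt0r tn0.
  by rewrite -subr_gt0 (_ : _ - _ = (1 - t) * (1 - nm a) + t * (1 - nm b)) ?ltr_wpDl //; ring.
split=> //; rewrite !poincareE; apply: atanh_le; rewrite ?pr_ge0 ?pr_lt1 //.
have hx := pseudo_ltr a1 x1; have hb := pseudo_ltr a1 b1.
have px : 0 < nm (1 - conjc x * a) by rewrite (le_lt_trans _ hx) // nm_ge0.
have pb : 0 < nm (1 - conjc b * a) by rewrite (le_lt_trans _ hb) // nm_ge0.
rewrite /pr !nm_div ler_pdivrMr // mulrAC ler_pdivlMr //.
have -> : nm (a - x) = t * nm (a - b).
  have -> : a - x = t%:C * (a - b) by rewrite /x; ring.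
  by rewrite nm_M nm_real ger0_norm.
rewrite mulrAC mulrC ler_wpM2l ?nm_ge0 //.
rewrite -(ler_pXn2r (n := 2)) ?nnegrE ?mulr_ge0 ?nm_ge0 // exprMn !nm_sqr.
have : nm a ^+ 2 < 1 by rewrite expr_lt1 // nm_ge0.
have : nm b ^+ 2 < 1 by rewrite expr_lt1 // nm_ge0.
rewrite !nm_sqr /x; clear -t0 t1; case: a b => [a1 a2] [b1 b2] /=.
set A := a1 ^+ 2 + _; set B := b1 ^+ 2 + _ => B1 A1.
have q1 : 0 <= 1 - (b1 * a1 + b2 * a2).
  have := sqr_ge0 (a1 - b1); have := sqr_ge0 (a2 - b2).
  rewrite /A /B in A1 B1; nra.
have p0 : 0 < 1 - A by lra.
rewrite -subr_ge0; set lhs := (X in 0 <= X).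
(* Expand the squared modulus of [1 - conjc x * a = (1 - t) (1 - A) + t (1 - conjc b * a)]: the term
   in [t ^+ 2] cancels, and the mixed term is nonnegative by [q1]. *)
have -> : lhs = (1 - t) * ((1 - A) *
    ((1 - A) * (1 - t) + 2 * t * (1 - (b1 * a1 + b2 * a2)))).
  by rewrite /lhs /A; ring.
have u0 : 0 <= 1 - t by rewrite subr_ge0.
have p1 := ltW p0.
apply: (mulr_ge0 u0); apply: (mulr_ge0 p1); apply: addr_ge0; apply: mulr_ge0 => //.
by rewrite mulr_ge0.
Qed.

(** From [ln (1 + x) <= x] the distance is at most [t / (1 - t)]. *)
Lemma poincare0_le (t : R) : 0 <= t -> t <= 2^-1 -> poincare (0 : R[i]) t%:C <= 2 * t.
Proof.
move=> t0 t1; rewrite poincareE /pr mulr0 subr0 divr1 sub0r nmN nm_real ger0_norm //.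
have q : 0 < 1 - t by lra.
have p : 0 < (1 + t) / (1 - t) by rewrite divr_gt0 //; lra.
apply: le_trans (_ : 2^-1 * ((1 + t) / (1 - t) - 1) <= _).
  rewrite ler_wpM2l // -[X in ln X](subrKC 1) le_ln1Dx // -subr_gt0 opprK subrK //.
have -> : 2^-1 * ((1 + t) / (1 - t) - 1) = t / (1 - t) by field; rewrite gt_eqF.
rewrite ler_pdivrMr //.
have -> : 2 * t * (1 - t) = t + t * (1 - 2 * t) by ring.
by rewrite lerDl mulr_ge0 //; lra.
Qed.

End Poincare.

(** * Holomorphy in charts *)

Section Charts.
Variable R : realType.

Lemma diff_near (V W : normedModType R[i]) (f g : V -> W) (x : V) :
  differentiable f x -> (\forall y \near x, f y = g y) ->
  differentiable g x /\ 'd g x = 'd f x :> (V -> W).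
Proof.
move=> df fg; have [C C0 hC] := diff_bounded df.
apply: (diff_of_nm _ hC) => [|e e0]; first exact: linearP.
have [d d0 dP] := diff_nm df e0.
have /nbhs_nm[r r0 rP] := fg.
exists (Num.min d r) => [|h]; first by rewrite lt_min d0.
rewrite lt_min => /andP[hd hr].
have <- : f (x + h) = g (x + h) by apply: rP; rewrite addrC addKr.
have <- : f x = g x by apply: rP; rewrite subrr nm0.
exact: dP.
Qed.

Lemma nbhsS (T : topologicalType) (x : T) (A B : set T) :
  (forall y, A y -> B y) -> nbhs x A -> nbhs x B.
Proof. by move=> AB; apply: filterS. Qed.

Lemma nbhs_preim (T U : topologicalType) (f : T -> U) (x : T) (A : set U) :
  {for x, continuous f} -> nbhs (f x) A -> nbhs x (fun y => A (f y)).
Proof. by move=> fc; exact: fc. Qed.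

Variables (n : nat) (M : complexManifold R n).
Implicit Types (z : M) (c d : chart R n M).

Lemma exists_chart z : exists c, chart_at z c.
Proof. by have [c ac cz] := atlas_cover z; exists c. Qed.

Lemma chart_nbhs z c : chart_at z c -> nbhs z (chart_dom c).
Proof. by move=> [_ cz]; apply: open_nbhs_nbhs; split => //; exact: chart_dom_open. Qed.

Lemma chart_ball z c : chart_at z c -> exists2 r : R, 0 < r &
  forall x, nm (x - c z) < r ->
    [/\ chart_dom c (chart_inv c x), c (chart_inv c x) = x &
        {for x, continuous (chart_inv c)}].
Proof.
move=> [_ cz].
have /nbhs_nm[r r0 rP] : nbhs (c z) (c @` chart_dom c).
  by apply: open_nbhs_nbhs; split; [exact: chart_im_open|exists z].
exists r => // x /rP [w cw <-]; rewrite chart_mapK //; split=> //.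
exact: chart_inv_cont.
Qed.

(** The transition maps are differentiable, so a single chart at [f a] decides. *)
Lemma cdiff_chart (V : normedModType R[i]) (f : V -> M) (a : V) c :
  {for a, continuous f} -> chart_at (f a) c -> differentiable (c \o f) a ->
  cdiff_at f a.
Proof.
move=> fc cfa dcf; split=> // d dfa.
have h : differentiable ((d \o chart_inv c) \o (c \o f)) a.
  apply: differentiable_comp => //.
  by case: cfa dfa => [? ?] [? ?]; exact: atlas_compat.
apply: (proj1 (diff_near h _)).
apply: nbhsS (nbhs_preim fc (chart_nbhs cfa)) => y /= cy.
by rewrite chart_mapK.
Qed.

(** Holomorphy at one point, so that the flow can be followed along a single orbit. *)
Definition holo_at (f : M -> M) z := forall c, chart_at z c ->
  cdiff_at (f \o chart_inv c) (c z).

Lemma cdiff_comp (V : normedModType R[i]) (f : V -> M) (g : M -> M) (a : V) :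
  cdiff_at f a -> holo_at g (f a) -> cdiff_at (g \o f) a.
Proof.
move=> [fc fd] gh; have [c cfa] := exists_chart (f a).
have [gc gd] := gh c cfa; have dcf := fd c cfa.
have near_eq : \forall y \near a, f y = chart_inv c (c (f y)).
  apply: nbhsS (nbhs_preim fc (chart_nbhs cfa)) => y /= cy.
  by rewrite chart_mapK.
have fa : chart_inv c (c (f a)) = f a by rewrite chart_mapK //; exact: (proj2 cfa).
have gfc : {for a, continuous (g \o f)}.
  have cc : {for a, continuous ((g \o chart_inv c) \o (c \o f))}.
    by apply: continuous_comp => //; exact: differentiable_continuous.
  move=> A hA; have h : nbhs a (fun y => A ((g \o chart_inv c) ((c \o f) y))).
    by apply: (nbhs_preim cc); rewrite /= fa.
  suff : nbhs a (fun y => A (g (f y))) by [].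
  by apply: nbhsS (filterI near_eq h) => y [e]; rewrite /= -e.
split=> // d dgfa.
have h : differentiable ((d \o (g \o chart_inv c)) \o (c \o f)) a.
  by apply: differentiable_comp => //; apply: gd; rewrite /= fa.
apply: (proj1 (diff_near h _)).
by apply: nbhsS near_eq => y /= <-.
Qed.

(** The explicit discs in [M] and the local flow are first constructed in a coordinate ball; this
    carries their holomorphy over to [M]. *)
Lemma cdiff_inv (V : normedModType R[i]) (F : V -> 'rV[R[i]]_n) (a : V) z c (r : R) :
  chart_at z c ->
  (forall x, nm (x - c z) < r ->
    [/\ chart_dom c (chart_inv c x), c (chart_inv c x) = x &
        {for x, continuous (chart_inv c)}]) ->
  differentiable F a -> nm (F a - c z) < r -> cdiff_at (chart_inv c \o F) a.
Proof.
move=> cz rP dF Far.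
have Fc : {for a, continuous F} by exact: differentiable_continuous.
have [dm _ ic] := rP _ Far.
apply: (@cdiff_chart _ _ _ c); first exact: continuous_comp.
  by split=> //; exact: (proj1 cz).
apply: (proj1 (diff_near dF _)).
have hb : nbhs (F a) [set x | nm (x - c z) < r].
  apply/nbhs_nm; exists (r - nm (F a - c z)); first by rewrite subr_gt0.
  by move=> y yF /=; apply: le_lt_trans (nmDB _ (F a) _) _; lra.
by apply: nbhsS (nbhs_preim Fc hb) => y /= /rP[_ -> _].
Qed.

End Charts.

(** * Compactness of closed balls *)

Section Compactness.
Variable R : realType.

Lemma closed_nm_le (V : normedModType R[i]) (x0 : V) (r : R) :
  closed [set x | nm (x - x0) <= r].
Proof.
move=> x /= xc; rewrite leNgt; apply/negP => rx.
have /xc[y [/= y1]] : nbhs x [set y | nm (y - x) < nm (x - x0) - r].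
  by apply/nbhs_nm; exists (nm (x - x0) - r) => //; rewrite subr_gt0.
rewrite nmBC => y2; have := nmDB x y x0; lra.
Qed.

Lemma nm_le_ReIm (z : R[i]) : nm z <= `|complex.Re z| + `|complex.Im z|.
Proof.
rewrite -(ler_pXn2r (n := 2)) ?nnegrE ?addr_ge0 ?nm_ge0 // nm_sqr.
rewrite sqrrD !real_normK ?num_real // addrAC lerDl.
by rewrite mulrn_wge0 // mulr_ge0.
Qed.

Lemma ReIm_le_nm (z : R[i]) : `|complex.Re z| <= nm z /\ `|complex.Im z| <= nm z.
Proof.
split; rewrite -(ler_pXn2r (n := 2)) ?nnegrE ?nm_ge0 // nm_sqr real_normK ?num_real //.
  by rewrite lerDl sqr_ge0.
by rewrite lerDr sqr_ge0.
Qed.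

Lemma compact_disc (x0 : R[i]) (r : R) : compact [set x : R[i] | nm (x - x0) <= r].
Proof.
pose f (p : R * R) : R[i] := Complex p.1 p.2 + x0.
have fc : continuous f.
  move=> p A /nbhs_nm[e e0 eA].
  have e2 : 0 < e / 2 by rewrite divr_gt0.
  exists ([set s | `|s - p.1| < e / 2], [set s | `|s - p.2| < e / 2]) => /=.
    by split; apply/nbhs_real; exists (e / 2).
  move=> q [/= q1 q2]; apply: eA.
  have -> : f q - f p = Complex (q.1 - p.1) (q.2 - p.2).
    by rewrite /f opprD addrACA subrr addr0.
  by apply: le_lt_trans (nm_le_ReIm _) _; rewrite /=; lra.
have hK : compact (f @` (`[- r, r]%classic `*` `[- r, r]%classic)).
  apply: continuous_compact; first exact: continuous_subspaceT.
  by apply: compact_setX; exact: segment_compact.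
apply: (subclosed_compact _ hK); first exact: closed_nm_le.
move=> x /= xr; have [h1 h2] := ReIm_le_nm (x - x0).
exists (complex.Re (x - x0), complex.Im (x - x0)).
  by split; rewrite /= in_itv /= -ler_norml; lra.
by rewrite /f /=; case: (x - x0) (subrK x0 x).
Qed.

Lemma nm_coord m (x : 'rV[R[i]]_m) (j : 'I_m) : nm (x ord0 j) <= nm x.
Proof.
rewrite -lecR -!nmE {2}/Num.norm /= mx_normE -[leLHS]nngE num_le.
by apply: (le_bigmax _ (fun i : 'I_1 * 'I_m => `|x i.1 i.2|%:nng) (ord0, j)).
Qed.

Lemma compact_nm_ball m (x0 : 'rV[R[i]]_m) (r : R) :
  compact [set x | nm (x - x0) <= r].
Proof.
have hK := @rV_compact R[i] m (fun j => [set z | nm (z - x0 ord0 j) <= r])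
  (fun j => @compact_disc _ _).
apply: (subclosed_compact _ hK); first exact: closed_nm_le.
move=> x /= xr j; apply: le_trans xr.
by have := nm_coord (x - x0) j; rewrite !mxE.
Qed.

End Compactness.

(** * The Kobayashi distance *)

Section Kobayashi.
Variables (R : realType) (n : nat) (M : complexManifold R n).
Implicit Types (z w : M) (c d : chart R n M).
Local Notation k := (@kobayashi R n M).
Local Notation V := 'rV[R[i]]_n.

Lemma chain_ge0 z w s : disc_chain z w s -> 0 <= s.
Proof.
move=> [m [p [f [a [b [_ _ _ h ->]]]]]]; apply: sumr_ge0 => j _.
have [_ aj bj _ _] := h j (ltn_ord j).
by apply: poincare_ge0; rewrite -unit_discE.
Qed.

Lemma chains_lbound z w : has_lbound [set s | disc_chain z w s].
Proof. by exists 0 => s /chain_ge0. Qed.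

Lemma kob_disc (f : R[i] -> M) (a b : R[i]) :
  holomorphic_disc f -> nm a < 1 -> nm b < 1 -> k (f a) (f b) <= poincare a b.
Proof.
move=> fh a1 b1; apply: ge_inf; first exact: chains_lbound.
exists 1%N, (fun j => if j == 0%N then f a else f b), (fun _ => f), (fun _ => a), (fun _ => b).
split=> //; last by rewrite big_ord1.
by case=> // _; split; rewrite ?unit_discE.
Qed.

Hypothesis kd : is_distance k.

Lemma kob_ge0 z w : 0 <= k z w. Proof. by case: kd. Qed.
Lemma kob_refl z : k z z = 0. Proof. by case: kd => _ /(_ z z) [_ ->]. Qed.
Lemma kob_sym z w : k z w = k w z. Proof. by case: kd. Qed.
Lemma kob_tri x y z : k x z <= k x y + k y z. Proof. by case: kd. Qed.
Lemma kob_gt0 z w : z <> w -> 0 < k z w.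
Proof.
move=> zw; rewrite lt0r kob_ge0 andbT; apply/eqP => kzw; apply: zw.
by case: kd => _ /(_ z w) [h _] _ _; exact: h.
Qed.

(* [inf set0 = 0], so points at positive distance are joined by a chain.     *)
Lemma kob_lt_chain z w (d : R) : z <> w -> k z w < d ->
  exists2 s, disc_chain z w s & s < d.
Proof.
move=> zw; apply: inf_lt; apply/set0P/eqP => e.
by have := kob_gt0 zw; rewrite /kobayashi e inf0 ltxx.
Qed.

(** Composition with [f] carries a chain to a chain of the same length. The case [z = w] is apart
    because [kob_lt_chain] provides chains between distinct points. *)
Lemma kob_contract (f : M -> M) z w : (forall x, holo_at f x) ->
  k (f z) (f w) <= k z w.
Proof.
move=> fh; have [->|zw] := pselect (z = w); first by rewrite !kob_refl.
rewrite leNgt; apply/negP => /(kob_lt_chain zw)[s sc].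
apply/negP; rewrite -leNgt; apply: ge_inf; first exact: chains_lbound.
move: sc => [m [p [g [a [b [m0 p0 pm h ->]]]]]].
exists m, (f \o p), (fun j => f \o g j), a, b; split=> //=.
- by rewrite p0.
- by rewrite pm.
move=> j jm; have [gh aj bj ga gb] := h j jm; split=> //.
- by move=> x xd; apply: cdiff_comp (fh _); exact: gh.
- by rewrite /= ga.
- by rewrite /= gb.
Qed.

Lemma affine_diff (W : normedModType R[i]) (x v : W) (a : R[i]) :
  differentiable (fun a : R[i] => x + a *: v) a.
Proof.
apply: (proj1 (@diff_of_nm _ _ _ _ _ (fun h : R[i] => h *: v) (nm v) _ _ _)).
- by move=> r y u; rewrite scalerDl scalerA.
- by move=> h; rewrite nmZ mulrC.
- move=> e e0; exists 1 => // h _; rewrite scalerDl addrA.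
  by rewrite [X in X - (x + _)]addrC addrK subrr nm0 mulr_ge0 ?nm_ge0 // ltW.
Qed.

(** Two points near the centre lie on an affine disc inside the chart, at the parameters [0] and
    [t], with [t] proportional to their distance; these parameters have Poincare distance at most
    [2 * t]. *)
Lemma kob_lip z c : chart_at z c -> exists r C : R, [/\ 0 < r, 0 <= C &
  (forall x, nm (x - c z) < r ->
    [/\ chart_dom c (chart_inv c x), c (chart_inv c x) = x &
        {for x, continuous (chart_inv c)}]) /\
  forall x y, nm (x - c z) < r -> nm (y - c z) < r ->
    k (chart_inv c x) (chart_inv c y) <= C * nm (x - y)].
Proof.
move=> cz; have [r0 r00 hr0] := chart_ball cz.
(* Discs of radius [4 * r] about points of the ball of radius [r] stay in the ball of radius
   [5 * r]. Points of the small ball are less than [2 * r] apart, so that [t] is at most 1/2. *)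
pose r := r0 / 5; have r_gt0 : 0 < r by rewrite divr_gt0.
have r5 : r0 = 5 * r by rewrite /r; field.
exists r, (2 / (4 * r)); split=> //; first by rewrite ltW // divr_gt0 ?mulr_gt0.
split=> [x xr|x y xr yr]; first by apply: hr0; lra.
have [->|xy] := eqVneq x y; first by rewrite kob_refl subrr nm0 mulr0.
have l0 : 0 < nm (y - x) by rewrite nm_gt0 subr_eq0 eq_sym.
have l2 : nm (y - x) < 2 * r by have := nmDB y (c z) x; rewrite (nmBC (c z)); lra.
have r4 : 0 < 4 * r by lra.
pose t := nm (y - x) / (4 * r).
have t0 : 0 <= t by rewrite ltW // divr_gt0.
have t1 : t <= 2^-1 by rewrite ler_pdivrMr //; lra.
pose v := (t^-1)%:C *: (y - x).
have tn0 : t != 0 by rewrite gt_eqF // divr_gt0.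
have nv : nm v = 4 * r.
  by rewrite nmZr ger0_norm ?invr_ge0 // /t invf_div divfK // gt_eqF.
pose F (a : R[i]) := x + a *: v.
have Fh : holomorphic_disc (chart_inv c \o F).
  move=> a; rewrite unit_discE => a1.
  apply: (cdiff_inv cz hr0); first exact: affine_diff.
  rewrite /F addrAC; apply: le_lt_trans (nmD _ _) _; rewrite nmZ nv.
  have : nm a * (4 * r) <= 4 * r by rewrite ger_pMl // ltW.
  lra.
have F0 : F 0 = x by rewrite /F scale0r addr0.
have Ft : F t%:C = y.
  by rewrite /F /v scalerA -rmorphM /= divff // scale1r subrKC.
have := kob_disc Fh (a := 0) (b := t%:C); rewrite nm0 nm_real ger0_norm //=.
rewrite F0 Ft => /(_ ltr01) h; apply: le_trans (h _) _; first lra.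
apply: le_trans (poincare0_le t0 t1) _.
by rewrite nmBC /t mulrA mulrAC.
Qed.

Lemma kob_small z (e : R) : 0 < e -> nbhs z [set w | k z w < e].
Proof.
move=> e0; have [c cz] := exists_chart z.
have [r [C [r0 C0 [hr kL]]]] := kob_lip cz.
have : nbhs (c z) [set x | nm (x - c z) < Num.min r (e / (C + 1))].
  apply/nbhs_nm; exists (Num.min r (e / (C + 1))) => //.
  by rewrite lt_min r0 divr_gt0 // ltr_wpDl.
move=> /(nbhs_preim (chart_map_cont (proj2 cz))) hb.
apply: nbhsS (filterI (chart_nbhs cz) hb) => w [/= dw].
rewrite lt_min => /andP[wr we].
rewrite -(chart_mapK (proj2 cz)) -(chart_mapK dw).
apply: le_lt_trans (kL _ _ _ wr) _; first by rewrite subrr nm0.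
have C1 : 0 < C + 1 by lra.
rewrite nmBC; move: we; rewrite ltr_pdivlMr // => we.
apply: le_lt_trans _ we; rewrite mulrDr mulr1 mulrC lerDl; exact: nm_ge0.
Qed.

Lemma kob_cont z w : {for (z, w), continuous (fun p : M * M => k p.1 p.2)}.
Proof.
move=> A /nbhs_real[e e0 eA]; have e2 : 0 < e / 2 by rewrite divr_gt0.
exists ([set z' | k z z' < e / 2], [set w' | k w w' < e / 2]) => /=.
  by split; exact: kob_small.
move=> [z' w'] [/= h1 h2]; apply: eA; rewrite /= ltr_norml.
have := kob_tri z z' w; have := kob_tri z' w' w; have := kob_tri z' z w'.
have := kob_tri z w w'; rewrite (kob_sym z' z) (kob_sym w' w) => *.
by apply/andP; split; lra.
Qed.

(** The pairs at distance at least [e] in the closed ball form a compact set on which k is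
    continuous and positive; its image is closed and misses [0]. The margin [2 * r] keeps the closed
    ball of radius [r] inside the image of the chart. *)
Lemma kob_separated z c : chart_at z c -> exists r : R, [/\ 0 < r,
  (forall x, nm (x - c z) < 2 * r ->
    [/\ chart_dom c (chart_inv c x), c (chart_inv c x) = x &
        {for x, continuous (chart_inv c)}]) &
  forall e : R, 0 < e -> exists2 d : R, 0 < d & forall x y,
    nm (x - c z) <= r -> nm (y - c z) <= r -> e <= nm (x - y) ->
    d <= k (chart_inv c x) (chart_inv c y)].
Proof.
move=> cz; have [r0 r00 hr0] := chart_ball cz.
pose r := r0 / 2; have r_gt0 : 0 < r by rewrite divr_gt0.
have r2 : r0 = 2 * r by rewrite /r; field.
exists r; split=> // [x xr|e e0]; first by apply: hr0; lra.
pose B : set V := [set x | nm (x - c z) <= r].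
pose S : set (V * V) := [set p | e <= nm (p.1 - p.2)].
have Sc : closed S.
  move=> p pc; rewrite /S /= leNgt; apply/negP => pe.
  pose q := (e - nm (p.1 - p.2)) / 2.
  have q0 : 0 < q by rewrite divr_gt0 // subr_gt0.
  have /pc[p' [/= S1 [h1 h2]]] : nbhs p ([set x | nm (x - p.1) < q] `*` [set x | nm (x - p.2) < q]).
    exists ([set x | nm (x - p.1) < q], [set x | nm (x - p.2) < q]) => //=.
    by split; apply/nbhs_nm; exists q.
  move: S1 h1 h2; rewrite /S /= => S1 h1 h2.
  have := nmDB p'.1 p.1 p'.2; have := nmDB p.1 p.2 p'.2; rewrite (nmBC p.2).
  by move: h1 h2; rewrite /q; lra.
have Kc : compact ((B `*` B) `&` S).
  by apply: compact_closedI => //; apply: compact_setX; exact: compact_nm_ball.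
pose phi (p : V * V) := k (chart_inv c p.1) (chart_inv c p.2).
have phic : {within (B `*` B) `&` S, continuous phi}.
  apply: continuous_in_subspaceT => p; rewrite inE => -[[/= p1 p2] _].
  have [_ _ i1] : [/\ chart_dom c (chart_inv c p.1), c (chart_inv c p.1) = p.1 &
    {for p.1, continuous (chart_inv c)}] by apply: hr0; move: p1; rewrite /B /=; lra.
  have [_ _ i2] : [/\ chart_dom c (chart_inv c p.2), c (chart_inv c p.2) = p.2 &
    {for p.2, continuous (chart_inv c)}] by apply: hr0; move: p2; rewrite /B /=; lra.
  move=> A hA; have [[A1 A2] /= [hA1 hA2] A12] := kob_cont hA.
  exists (chart_inv c @^-1` A1, chart_inv c @^-1` A2); first by split; [exact: i1|exact: i2].
  by move=> p' [/= h1 h2]; apply: (A12 (_, _)).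
have Ic := compact_closed (@Rhausdorff R) (continuous_compact phic Kc).
have : nbhs (0 : R) (~` (phi @` ((B `*` B) `&` S))).
  apply: open_nbhs_nbhs; split; first exact: closed_openC.
  move=> [[x y] [[/= Bx By] Sxy]]; apply/eqP; rewrite gt_eqF // /phi /=.
  apply: kob_gt0 => exy.
  have [_ cx _] : [/\ chart_dom c (chart_inv c x), c (chart_inv c x) = x &
    {for x, continuous (chart_inv c)}] by apply: hr0; move: Bx; rewrite /B /=; lra.
  have [_ cy _] : [/\ chart_dom c (chart_inv c y), c (chart_inv c y) = y &
    {for y, continuous (chart_inv c)}] by apply: hr0; move: By; rewrite /B /=; lra.
  by move: Sxy; rewrite /S /= -cx -cy exy subrr nm0; lra.
move=> /nbhs_real[d d0 hd]; exists d => // x y xr yr exy.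
rewrite leNgt; apply/negP => kd'; apply: (hd (phi (x, y))).
  by rewrite subr0 ger0_norm ?kob_ge0.
by exists (x, y).
Qed.

End Kobayashi.

(** * Estimates for bounded holomorphic maps *)

Section Cauchy.
Variables (R : realType).

Lemma le0_half (a b : R) : (forall j, a <= b / 2 ^+ j) -> a <= 0.
Proof.
move=> h; rewrite leNgt; apply/negP => a0.
pose m := Num.truncn (`|b| / a).
have hm : `|b| / a < m.+1%:R by exact: truncnS_gt.
have := h m.+1; rewrite ler_pdivlMr ?exprn_gt0 // leNgt => /negP; apply.
apply: le_lt_trans (ler_norm b) _.
move: hm; rewrite ltr_pdivrMr // mulrC => hm; apply: lt_le_trans hm _.
by rewrite ler_pM2l // -natrX ler_nat ltnW // ltn_expl.
Qed.

Lemma exp2_large (x d : R) : 0 < d -> exists J, forall j, (J <= j)%N -> x < 2 ^+ j * d.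
Proof.
move=> d0; exists (Num.truncn (x / d)).+1 => j hj.
have := truncnS_gt (x / d); rewrite ltr_pdivrMr // => h; apply: lt_le_trans h _.
rewrite ler_pM2r // -natrX ler_nat (leq_trans hj) // ltnW // ltn_expl //.
Qed.

Lemma diff_lip_bound (V W : normedModType R[i]) (F : V -> W) (x : V) (L r : R) :
  0 < r -> differentiable F x ->
  (forall h, nm h <= r -> nm (F (x + h) - F x) <= L * nm h) ->
  forall v, nm ('d F x v) <= L * nm v.
Proof.
move=> r0 dF hL v; have [->|v0] := eqVneq v 0; first by rewrite linear0 !nm0 mulr0.
have nv : 0 < nm v by rewrite nm_gt0.
apply/ler_addgt0Pr => e e0.
have [d d0 hd] := diff_nm dF (divr_gt0 e0 nv).
pose m := Num.min d r; have m0 : 0 < m by rewrite lt_min d0.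
pose q := m / (2 * nm v); have q0 : 0 < q by rewrite divr_gt0 ?mulr_gt0.
have nq : nm (q%:C *: v) = m / 2.
  by rewrite nmZr gtr0_norm // /q; field; rewrite gt_eqF.
have md : m <= d by rewrite ge_min lexx.
have mr : m <= r by rewrite ge_min lexx orbT.
have h1 := hd (q%:C *: v) ltac:(by rewrite nq; lra).
have h2 := hL (q%:C *: v) ltac:(by rewrite nq; lra).
rewrite -(ler_pM2l q0).
have -> : q * nm ('d F x v) = nm ('d F x (q%:C *: v)).
  by rewrite linearZ /= nmZr gtr0_norm.
have h3 := nmDB ('d F x (q%:C *: v)) (F (x + q%:C *: v) - F x) 0.
rewrite !subr0 nmBC in h3; apply: le_trans h3 _.
have -> : q * (L * nm v + e) = e / nm v * (q * nm v) + L * (q * nm v).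
  by field; rewrite gt_eqF.
have <- : nm (q%:C *: v) = q * nm v by rewrite nmZr gtr0_norm.
exact: lerD.
Qed.

(** The remainder at [v] is a second difference with step [v / 2] plus twice the remainder at
    [v / 2]. In a bound [e * nm v + C * nm v ^+ 2] the linear part reproduces itself under halving,
    and the quadratic part returns with [C / 4 + C / 2 <= C]. The halvings end where
    differentiability itself gives [e * nm v]. *)
Lemma taylor_of_second_diff n (F : 'rV[R[i]]_n -> 'rV[R[i]]_n) (x : 'rV[R[i]]_n) (C r : R) :
  0 <= C -> differentiable F x ->
  (forall v, nm v <= r ->
    nm (F (x + v + v) - F (x + v) - (F (x + v) - F x)) <= C * (nm v * nm v)) ->
  forall h, nm h <= r -> nm (F (x + h) - F x - 'd F x h) <= C * nm h ^+ 2.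
Proof.
move=> C0 dF hsec h hr; apply/ler_addgt0Pr => e0 e00.
have n1 : 0 < nm h + 1 by rewrite ltr_wpDl ?nm_ge0.
pose e := e0 / (nm h + 1); have ep : 0 < e by rewrite divr_gt0.
have [d d0 hd] := diff_nm dF ep.
suff hj j v : nm v < 2 ^+ j * d -> nm v <= r ->
    nm (F (x + v) - F x - 'd F x v) <= e * nm v + C * nm v ^+ 2.
  have [J hJ] := exp2_large (nm h) d0.
  apply: le_trans (hj J h (hJ J (leqnn J)) hr) _; rewrite addrC lerD2l /e.
  by rewrite mulrAC ler_pdivrMr // ler_pM2l // lerDl.
elim: j v => [|j IH] v hj vr.
  rewrite expr0 mul1r in hj; apply: le_trans (hd _ hj) _.
  by rewrite lerDl mulr_ge0 ?exprn_ge0 ?nm_ge0.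
pose u : 'rV[R[i]]_n := (2^-1)%:C *: v.
have nu : nm u = nm v / 2 by rewrite nmZr gtr0_norm ?invr_gt0 // mulrC.
have vu : v = u + u.
  by rewrite /u -scalerDl -rmorphD /= (_ : 2^-1 + 2^-1 = 1 :> R) ?scale1r //; lra.
have nv0 := nm_ge0 v.
have ur : nm u <= r by rewrite nu; move: vr nv0; clear; lra.
have uj : nm u < 2 ^+ j * d by rewrite nu ltr_pdivrMr // mulrAC -exprSr.
have IHu := IH u uj ur; have hS := hsec u ur.
have -> : F (x + v) - F x - 'd F x v =
    (F (x + u + u) - F (x + u) - (F (x + u) - F x)) +
     (2 : R)%:C *: (F (x + u) - F x - 'd F x u).
  rewrite {1 2}vu linearD addrA rmorphD rmorph1 scalerDl !scale1r.
  by apply/rowP => i; rewrite !mxE; ring.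
apply: le_trans (nmD _ _) _; rewrite nmZr gtr0_norm //.
have E : C * (nm u * nm u) + 2 * (e * nm u + C * nm u ^+ 2) =
    e * nm v + C * nm v ^+ 2 * (3 / 4) by rewrite nu; field.
have IH2 : 2 * nm (F (x + u) - F x - 'd F x u) <= 2 * (e * nm u + C * nm u ^+ 2).
  by rewrite ler_pM2l.
apply: le_trans (lerD hS IH2) _.
by rewrite E lerD2l ler_piMr ?mulr_ge0 ?exprn_ge0 //; lra.
Qed.

Lemma diff_translate (V W : normedModType R[i]) (F : V -> W) (h y : V) :
  differentiable F (y + h) -> differentiable (fun y => F (y + h)) y.
Proof.
move=> dF; have [C C0 hC] := diff_bounded dF.
apply: (proj1 (diff_of_nm _ hC _)) => [|e e0]; first exact: linearP.
have [d d0 dP] := diff_nm dF e0; exists d => // v /dP.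
by rewrite (addrAC y).
Qed.

Variables (n : nat) (M : complexManifold R n) (z0 : M).
Hypothesis kd : is_distance (@kobayashi R n M).
Local Notation V := 'rV[R[i]]_n.

Definition bounded_holo (F : V -> V) (x : V) (r B : R) :=
  forall y, nm (y - x) < r -> differentiable F y /\ nm (F y) <= B.

Lemma bounded_holo_sub F x y r s B : bounded_holo F x r B ->
  nm (y - x) + s <= r -> bounded_holo F y s B.
Proof. by move=> h xs u us; apply: h; have := nmDB u y x; lra. Qed.

Lemma bounded_holo_ge0 F x r B : 0 < r -> bounded_holo F x r B -> 0 <= B.
Proof.
move=> r0 h; have [_] : differentiable F x /\ nm (F x) <= B.
  by apply: h; rewrite subrr nm0.
by apply: le_trans; exact: nm_ge0.
Qed.

(** Scale-invariant: [t] and [a] serve all maps, centres and radii at once, so the estimate may be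
    applied again to a difference of translates of a map. *)
Definition oscillation (t a : R) := forall F x r B, 0 < r -> bounded_holo F x r B ->
  forall h, nm h <= t * r -> nm (F (x + h) - F x) <= a * B.

Lemma oscillation_le t a b : a <= b -> oscillation t a -> oscillation t b.
Proof.
move=> ab o F x r B r0 hF h ht; apply: le_trans (o _ _ _ _ r0 hF _ ht) _.
by rewrite ler_wpM2r // (bounded_holo_ge0 r0 hF).
Qed.

(* Scale the map into a chart of [M]: [k] does not increase along its discs, *)
(* while it separates points of the chart at a given distance.               *)
Lemma oscillation_start : exists t : R, [/\ 0 < t, t <= 2^-1 & oscillation t 4^-1].
Proof.
have [c cz] := exists_chart z0.
have [r [r0 hr ksep]] := kob_separated kd cz.
have [d d0 hd] := ksep (r / 4) ltac:(by rewrite divr_gt0).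
(* The parameters [0] and [t] of the disc below have Poincare distance at most [2 * t <= d / 2], too
   small for two points that are [r / 4] apart in the chart. *)
have m0 : 0 < Num.min 2^-1 (d / 4) by rewrite lt_min; apply/andP; split; lra.
exists (Num.min 2^-1 (d / 4)); split=> //.
- by rewrite ge_min lexx.
set t := Num.min _ _ => F x s B s0 hF h ht.
have t0 : 0 < t := m0.
have t2 : t <= 2^-1 by rewrite ge_min lexx.
have td : t <= d / 4 by rewrite ge_min lexx orbT.
have B0 := bounded_holo_ge0 s0 hF.
rewrite leNgt; apply/negP => hB.
have hts : t * s < s by rewrite gtr_pMl //; lra.
have [_ Fx] : differentiable F x /\ nm (F x) <= B by apply: hF; rewrite subrr nm0.
have [_ Fh] : differentiable F (x + h) /\ nm (F (x + h)) <= B.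
  by apply: hF; rewrite addrC addKr; lra.
have Bp : 0 < B.
  rewrite lt0r B0 andbT; apply/eqP => B00.
  by have := nmB (F (x + h)) (F x); rewrite B00 in hB Fx Fh; lra.
(* This factor brings the values of [F], bounded by [B], into the ball of radius [r], and turns
   [B / 4] into [r / 4]. *)
pose q := r / B; have q0 : 0 < q by rewrite divr_gt0.
have qB u : nm (F u) <= B -> nm (c z0 + q%:C *: F u - c z0) <= r.
  move=> Fu; rewrite addrC addKr nmZr gtr0_norm // /q mulrAC ler_pdivrMr //.
  by rewrite ler_pM2l.
pose v : V := (t^-1)%:C *: h.
have nv : nm v <= s.
  by rewrite nmZr gtr0_norm ?invr_gt0 // ler_pdivrMl.
have av (a : R[i]) : nm a < 1 -> nm (x + a *: v - x) < s.
  move=> a1; rewrite addrC addKr nmZ.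
  have : nm a * nm v <= nm a * s by rewrite ler_wpM2l ?nm_ge0.
  have : nm a * s < s by rewrite gtr_pMl.
  lra.
pose G (a : R[i]) := c z0 + q%:C *: F (x + a *: v).
have Gh : holomorphic_disc (chart_inv c \o G).
  move=> a; rewrite unit_discE => a1; have [dF nF] := hF _ (av _ a1).
  apply: (cdiff_inv cz hr); last by have := qB _ nF; rewrite /G; lra.
  apply: differentiableD => //; apply: differentiableZ.
  by apply: (differentiable_comp (affine_diff x v a) dF).
have t1 : nm (t%:C : R[i]) < 1 by rewrite nm_real gtr0_norm //; lra.
have := kob_disc Gh (a := 0) (b := t%:C); rewrite nm0 => /(_ ltr01 t1) h1.
have G0 : G 0 = c z0 + q%:C *: F x by rewrite /G scale0r addr0.
have Gt : G t%:C = c z0 + q%:C *: F (x + h).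
  by rewrite /G /v scalerA -rmorphM /= divff ?scale1r // gt_eqF.
have := hd _ _ (qB _ Fx) (qB _ Fh); rewrite -G0 -Gt.
have -> : nm (G 0 - G t%:C) = q * nm (F (x + h) - F x).
  by rewrite G0 Gt opprD addrACA subrr add0r -scalerBr nmZr gtr0_norm // nmBC.
have -> : r / 4 = q * (4^-1 * B) by rewrite /q; field; rewrite gt_eqF.
rewrite ler_pM2l // => /(_ (ltW hB)) h2.
have := poincare0_le (ltW t0) t2; move: h1 h2 => /=; lra.
Qed.

(* The identity [2 D_h F = D_2h F - D_h D_h F] on a ball of half the radius. *)
Lemma oscillation_half t a : 0 <= t -> t <= 2^-1 -> 0 <= a ->
  oscillation t a -> oscillation (t / 2) (a * (1 + a) / 2).
Proof.
move=> t0 t2 a0 o F x r B r0 hF h ht.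
have B0 := bounded_holo_ge0 r0 hF.
have r2 : 0 < r / 2 by rewrite divr_gt0.
have ht2 : nm h <= t * (r / 2) by lra.
have tr : t * (r / 2) <= r / 2 by rewrite ger_pMl //; lra.
pose G y := F (y + h) - F y.
have hG : bounded_holo G x (r / 2) (a * B).
  move=> y yr; split.
    apply: differentiableB; last by apply: (proj1 (hF _ _)); lra.
    apply: diff_translate; apply: (proj1 (hF _ _)).
    by rewrite addrAC; apply: le_lt_trans (nmD _ _) _; lra.
  by apply: (o _ _ _ _ r2) => //; apply: bounded_holo_sub hF _; lra.
have h1 := o _ _ _ _ r2 hG _ ht2.
have h2 : nm (F (x + (h + h)) - F x) <= a * B.
  by apply: (o _ _ _ _ r0 hF); apply: le_trans (nmD _ _) _; lra.
have : nm (F (x + (h + h)) - F x - (G (x + h) - G x)) <= a * B + a * (a * B).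
  by apply: le_trans (nmB _ _) _; lra.
have -> : F (x + (h + h)) - F x - (G (x + h) - G x) = (2 : R)%:C *: (F (x + h) - F x).
  by rewrite /G addrA rmorphD rmorph1 scalerDl !scale1r; apply/rowP => j; rewrite !mxE; ring.
rewrite nmZr ger0_norm // => h3.
by lra.
Qed.

(** The factor is 1/4 at [j = 0] and dominates the recursion [a * (1 + a) / 2]: with [P = 2 ^+ j]
    this amounts to [(2 * P + 3) * (2 * P + 1) <= 4 * (P + 1) ^+ 2], where the sides differ by 1. Up
    to a constant it is as small as the radius [t / 2 ^+ j]. *)
Lemma oscillation_pow t : 0 <= t -> t <= 2^-1 -> oscillation t 4^-1 ->
  forall j, oscillation (t / 2 ^+ j) (2 * (2 ^+ j + 1))^-1.
Proof.
move=> t0 t2 o; elim=> [|j IH].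
  by rewrite expr0 divr1 (_ : 2 * (1 + 1) = 4 :> R) //; ring.
have p1 : 1 <= 2 ^+ j :> R by rewrite exprn_ege1 // ler1n.
have p0 : 0 < 2 ^+ j :> R by lra.
have -> : t / 2 ^+ j.+1 = t / 2 ^+ j / 2 by rewrite exprSr invfM mulrA.
have := oscillation_half _ _ _ IH; rewrite exprSr.
have -> : 0 <= t / 2 ^+ j by rewrite divr_ge0 // ltW.
have -> : t / 2 ^+ j <= 2^-1 by rewrite ler_pdivrMr //; nra.
have -> : 0 <= (2 * (2 ^+ j + 1) : R)^-1 by rewrite invr_ge0; lra.
move=> /(_ isT isT isT); apply: oscillation_le.
have q0 : 0 < 2 * (2 ^+ j + 1) :> R by lra.
have q1 : 0 < 2 * (2 ^+ j * 2 + 1) :> R by lra.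
set P := 2 ^+ j in p1 p0 q0 q1 *.
have -> : (2 * (P + 1))^-1 * (1 + (2 * (P + 1))^-1) / 2 =
  (2 * P + 3) / (8 * (P + 1) ^+ 2) by field; lra.
have P2 : 0 < 8 * (P + 1) ^+ 2 by rewrite mulr_gt0 // exprn_gt0 //; lra.
rewrite ler_pdivrMr // ler_pdivlMl //.
by rewrite -subr_ge0 (_ : _ - _ = 2) //; ring.
Qed.

(** A vector [h] that violates the bound and lies within [t * r / 2 ^+ j] must lie within half of
    that, by the oscillation estimate at this scale. Hence [h = 0], which does not violate it. *)
Lemma holo_lip : exists t : R, [/\ 0 < t, t <= 2^-1 &
  forall F x r B, 0 < r -> bounded_holo F x r B ->
  forall h, nm h <= t * r -> nm (F (x + h) - F x) <= B / (t * r) * nm h].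
Proof.
have [t [t0 t2 o]] := oscillation_start; exists t; split=> // F x r B r0 hF h ht.
have o' := oscillation_pow (ltW t0) t2 o.
have B0 := bounded_holo_ge0 r0 hF.
have tr : 0 < t * r by rewrite mulr_gt0.
rewrite leNgt; apply/negP => hB.
suff h0 : nm h <= 0.
  have /nm_eq0 e : nm h = 0 by apply/le_anti; rewrite h0 nm_ge0.
  by move: hB; rewrite e addr0 subrr nm0 mulr0 ltxx.
apply: (@le0_half _ (t * r)); elim=> [|j IH]; first by rewrite expr0 divr1.
rewrite leNgt; apply/negP => hj.
have := o' j F x r B r0 hF h; rewrite mulrAC => /(_ IH).
rewrite leNgt => /negP; apply; apply: le_lt_trans hB.
have p0 : 0 < 2 ^+ j :> R by rewrite exprn_gt0.
have -> : B / (t * r) * nm h = B * (nm h / (t * r)) by rewrite mulrAC mulrA.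
rewrite mulrC ler_wpM2l // ler_pdivlMr //.
apply: le_trans (ltW hj); rewrite mulrC ler_pM2l // exprSr.
by rewrite lef_pV2 ?posrE ?mulr_gt0 //; lra.
Qed.

(** The Lipschitz bound is used for [F] and then for its difference with step [v], both times on
    balls of radius [r / 2], whence the factor 4. *)
Lemma holo_second_diff : exists t : R, [/\ 0 < t, t <= 2^-1 &
  forall F x r B, 0 < r -> bounded_holo F x r B ->
  (forall h, nm h <= t * r -> nm (F (x + h) - F x) <= B / (t * r) * nm h) /\
  forall h v, nm h <= t * r / 2 -> nm v <= t * r / 2 ->
  nm (F (x + h + v) - F (x + h) - (F (x + v) - F x)) <=
    4 * B / (t * r) ^+ 2 * (nm h * nm v)].
Proof.
have [t [t0 t2 hL]] := holo_lip; exists t; split=> // F x r B r0 hF.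
split=> [|h v hh hv]; first exact: hL.
have B0 := bounded_holo_ge0 r0 hF.
have r2 : 0 < r / 2 by rewrite divr_gt0.
have tr : t * (r / 2) <= r / 2 by rewrite ger_pMl //; lra.
have tr0 : 0 < t * r by rewrite mulr_gt0.
pose G y := F (y + v) - F y.
have hG : bounded_holo G x (r / 2) (B / (t * (r / 2)) * nm v).
  move=> y yr; split.
    apply: differentiableB; last by apply: (proj1 (hF _ _)); lra.
    apply: diff_translate; apply: (proj1 (hF _ _)).
    by rewrite addrAC; apply: le_lt_trans (nmD _ _) _; lra.
  by apply: (hL _ _ _ _ r2); [apply: bounded_holo_sub hF _|]; lra.
have := hL _ _ _ _ r2 hG h; rewrite /G => hh'.
apply: le_trans (hh' _) _; first lra.
rewrite le_eqVlt; apply/orP; left; apply/eqP; field.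
by rewrite !gt_eqF.
Qed.

Lemma holo_local (F : V -> V) (x0 : V) (r0 : R) : 0 < r0 ->
  (forall x, nm (x - x0) < r0 -> differentiable F x) ->
  exists r B L C : R, [/\ 0 < r, r <= r0, [/\ 0 < B, 0 < L & 0 < C],
   (forall x, nm (x - x0) < r -> nm (F x) <= B) &
   forall x y, nm (x - x0) < r -> nm (y - x0) < r ->
   [/\ nm (F y - F x) <= L * nm (y - x),
       nm (F y - F x - 'd F x (y - x)) <= C * nm (y - x) ^+ 2 &
       forall v, nm ('d F x v) <= L * nm v]].
Proof.
move=> r00 dF; have [t [t0 t2 ht]] := holo_second_diff.
have dx0 : differentiable F x0 by apply: dF; rewrite subrr nm0.
have /cvg_nm /(_ _ ltr01)[s s0 hs] := differentiable_continuous dx0.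
pose B := nm (F x0) + 1; have B0 : 0 < B by rewrite ltr_wpDl ?nm_ge0.
pose rho := Num.min s r0; have rho0 : 0 < rho by rewrite lt_min s0.
have hF : bounded_holo F x0 rho B.
  move=> y; rewrite lt_min => /andP[ys yr]; split; first exact: dF.
  by have := hs _ ys; have := nmB_le (F y) (F x0); rewrite /B; lra.
pose T := t * (rho / 2); have T0 : 0 < T by rewrite mulr_gt0 // divr_gt0.
have Tr : T <= rho / 4.
  have : t * (rho / 2) <= 2^-1 * (rho / 2) by rewrite ler_wpM2r // ltW // divr_gt0.
  by rewrite /T; lra.
have rr : rho <= r0 by rewrite ge_min lexx orbT.
(* Points within [T / 4] of the centre are less than [T / 2] apart, which is the range of the second
   differences on balls of radius [rho / 2]. *)
exists (T / 4), B, (B / T), (4 * B / T ^+ 2); split.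
- by rewrite divr_gt0.
- by lra.
- by rewrite !divr_gt0 ?mulr_gt0 ?exprn_gt0.
- by move=> x xr; apply: (proj2 (hF _ _)); lra.
move=> x y xr yr.
have r2 : 0 < rho / 2 by rewrite divr_gt0.
have hFx : bounded_holo F x (rho / 2) B by apply: bounded_holo_sub hF _; lra.
have [hlip hsec] := ht _ _ _ _ r2 hFx; rewrite -/T in hlip hsec.
set L := B / T in hlip *; set C := 4 * B / T ^+ 2 in hsec *.
have C0 : 0 < C by rewrite divr_gt0 ?mulr_gt0 ?exprn_gt0.
have yx : nm (y - x) <= T / 2 by have := nmDB y x0 x; rewrite (nmBC x0); lra.
have dFx : differentiable F x by apply: dF; lra.
split.
- by have := hlip (y - x); rewrite subrKC; apply; lra.
- have hs2 (v : V) : nm v <= T / 2 ->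
      nm (F (x + v + v) - F (x + v) - (F (x + v) - F x)) <= C * (nm v * nm v).
    by move=> vT; exact: hsec.
  by have := taylor_of_second_diff (ltW C0) dFx hs2 yx; rewrite subrKC.
exact: diff_lip_bound T0 dFx hlip.
Qed.

End Cauchy.

(** * Differential inequalities and differential equations *)

Section RealLine.
Variable R : realType.

(** Continuous induction, through the supremum of the times up to which [Q] holds. It serves for
    uniqueness of integral curves, for paths inside a chain of discs and for holomorphy of the
    flow. *)
Lemma real_ind (Q : R -> Prop) (a b : R) : a <= b -> Q a ->
  (forall t, a <= t < b -> (forall s, a <= s <= t -> Q s) ->
    exists2 d : R, 0 < d & forall s, t < s < t + d -> s <= b -> Q s) ->
  (forall t, a < t <= b -> (forall s, a <= s < t -> Q s) -> Q t) ->
  forall t, a <= t <= b -> Q t.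
Proof.
move=> ab Qa Qr Ql.
pose S : set R := [set t | a <= t <= b /\ forall s, a <= s <= t -> Q s].
have Sa : S a.
  by split=> [|s /andP[? ?]]; [rewrite lexx|have -> : s = a by apply/le_anti/andP].
have Sub : ubound S b by move=> t [/andP[]].
have Ssup : has_sup S by split; [exists a|exists b].
pose T := sup S.
have aT : a <= T by apply: ub_le_sup => //; exists b.
have Tb : T <= b by apply: ge_sup => //; exists a.
have QT s : a <= s < T -> Q s.
  move=> /andP[as_ sT]; have [t [_ St] st] := sup_gt (ex_intro _ a Sa) sT.
  by apply: St; rewrite as_ ltW.
have QTT : Q T.
  have [<-//|nT] := eqVneq a T.
  by apply: Ql => //; rewrite lt_neqAle nT aT.
have QleT s : a <= s <= T -> Q s.
  move=> /andP[as_]; rewrite le_eqVlt => /orP[/eqP->//|sT].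
  by apply: QT; rewrite as_.
suff -> : b = T by [].
apply/le_anti; rewrite Tb andbT leNgt; apply/negP => Tltb.
have [d d0 hd] := Qr T ltac:(by rewrite aT Tltb) QleT.
pose m := Num.min (d / 2) (b - T).
have m0 : 0 < m by rewrite lt_min; apply/andP; split; lra.
have md : m <= d / 2 by rewrite ge_min lexx.
have mb : m <= b - T by rewrite ge_min lexx orbT.
have : T + m <= T.
  apply: ub_le_sup; first by exists b.
  split=> [|s /andP[as_ sm]]; first by apply/andP; split; lra.
  have [sT|Ts] := leP s T; first by apply: QleT; rewrite as_.
  by apply: hd; [apply/andP; split|]; lra.
lra.
Qed.

(** Only some arbitrarily small steps [h] are assumed to have little growth, which is all that a
    lower limit provides. The supremum of the [t] with [phi t <= phi a + e * (t - a)] belongs to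
    this set by semicontinuity from the left, and if it were less than [b], one step to its right
    would exceed it. *)
Lemma dini_le (phi : R -> R) (a b : R) : a <= b ->
  (forall t, a < t <= b -> forall e, 0 < e -> exists2 d : R, 0 < d &
    forall s, a <= s <= t -> t - s < d -> phi t <= phi s + e) ->
  (forall t, a <= t < b -> forall e d, 0 < e -> 0 < d ->
    exists h, [/\ 0 < h, h < d, t + h <= b & phi (t + h) <= phi t + e * h]) ->
  phi b <= phi a.
Proof.
move=> ab lsc hr.
suff he e : 0 < e -> phi b <= phi a + e * (b - a).
  rewrite leNgt; apply/negP => lt.
  have [ba|ba] := eqVneq a b; first by rewrite ba ltxx in lt.
  have p : 0 < b - a by rewrite subr_gt0 lt_neqAle ba.
  have e0 : 0 < (phi b - phi a) / (2 * (b - a)).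
    by rewrite divr_gt0 ?subr_gt0 ?mulr_gt0 // -subr_gt0.
  have := he _ e0.
  have -> : (phi b - phi a) / (2 * (b - a)) * (b - a) = (phi b - phi a) / 2.
    by field; rewrite gt_eqF.
  lra.
move=> e0; pose S : set R := [set t | a <= t <= b /\ phi t <= phi a + e * (t - a)].
have Sa : S a by split; [rewrite lexx|lra].
have Ssup : has_sup S by split; [exists a|exists b => t [/andP[]]].
pose T := sup S.
have aT : a <= T by apply: ub_le_sup => //; exists b => t [/andP[]].
have Tb : T <= b by apply: ge_sup; [exists a|move=> t [/andP[]]].
have ST : phi T <= phi a + e * (T - a).
  have [<-|nT] := eqVneq a T; first by lra.
  have aT' : a < T by rewrite lt_neqAle nT.
  rewrite leNgt; apply/negP => lt.
  pose g := phi T - (phi a + e * (T - a)).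
  have g0 : 0 < g by rewrite subr_gt0.
  have [d d0 hd] := lsc T ltac:(by rewrite aT' Tb) (g / 2) ltac:(by rewrite divr_gt0).
  have [s [/andP[as_ sb] hs] sT] := sup_gt (ex_intro _ a Sa) (ltac:(lra) : T - d < T).
  have sT' : s <= T by apply: ub_le_sup; [exists b => t [/andP[]]|split=> //; rewrite as_].
  have := hd s ltac:(by rewrite as_ sT') ltac:(lra).
  have : e * (s - a) <= e * (T - a) by rewrite ler_pM2l // lerD2r.
  by move: g0; rewrite /g; lra.
have [Tlt|bT] := ltP T b; last first.
  by have -> : b = T by apply/le_anti; rewrite bT Tb.
have [h [h0 _ hb hh]] := hr T ltac:(by rewrite aT Tlt) e 1 e0 ltr01.
have : T + h <= T.
  apply: ub_le_sup; first by exists b => t [/andP[]].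
  split; first by apply/andP; split; lra.
  have -> : e * (T + h - a) = e * (T - a) + e * h by ring.
  lra.
lra.
Qed.

(** Right derivatives suit Euler polygons, which have corners; the clause [t + h <= b] stays within
    the interval where the curve is known. *)
Definition right_der (W : normedModType R[i]) (g : R -> W) (t b : R) (v : W) :=
  forall e : R, 0 < e -> exists2 d : R, 0 < d & forall h, 0 < h -> h < d -> t + h <= b ->
    nm (g (t + h) - g t - h%:C *: v) <= e * h.

Definition left_cont (W : normedModType R[i]) (g : R -> W) (a t : R) :=
  forall e : R, 0 < e -> exists2 d : R, 0 < d &
    forall s, a <= s <= t -> t - s < d -> nm (g t - g s) <= e.

(* The weight [1 - L * (t - a)] replaces the exponential. *)
Lemma gronwall (W : normedModType R[i]) (g : R -> W) (a b L K : R) :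
  a <= b -> 0 <= L -> 0 <= K -> L * (b - a) <= 2^-1 ->
  (forall t, a < t <= b -> left_cont g a t) ->
  (forall t, a <= t < b -> exists2 v, nm v <= L * nm (g t) + K & right_der g t b v) ->
  nm (g b) <= 2 * (nm (g a) + K * (b - a)).
Proof.
move=> ab L0 K0 Lab gc gd.
pose phi t := nm (g t) * (1 - L * (t - a)) - K * (t - a).
have Lle t : t <= b -> L * (t - a) <= 2^-1.
  by move=> tb; apply: le_trans Lab; rewrite ler_wpM2l // lerD2r.
have Lge t : a <= t -> 0 <= L * (t - a).
  by move=> at_; rewrite mulr_ge0 // subr_ge0.
have : phi b <= phi a.
  apply: dini_le => // [t /andP[at_ tb] e e0|t /andP[at_ tb] e d e0 d0].
    have [d d0 hd] := gc t ltac:(by rewrite at_) e e0.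
    exists d => // s /andP[as_ st] tsd.
    have h1 := hd s ltac:(by rewrite as_) tsd.
    have h2 := nmB_le (g t) (g s).
    have h3 : K * (s - a) <= K * (t - a) by rewrite ler_wpM2l // lerD2r.
    have h4 : L * (s - a) <= L * (t - a) by rewrite ler_wpM2l // lerD2r.
    have h5 := Lle _ tb; have h6 := Lge _ as_; have g0 := nm_ge0 (g t).
    rewrite /phi; set u := nm (g t) in h2 g0 *; set w := nm (g s) in h2 *.
    set l := L * (t - a) in h4 h5 *; set l' := L * (s - a) in h4 h6 *.
    have h7 : u * (1 - l) <= u * (1 - l') by rewrite ler_wpM2l //; lra.
    have h8 : (u - w) * (1 - l') <= e.
      have [uw|wu] := leP u w.
        apply: le_trans (ltW e0); rewrite mulr_le0_ge0 //; lra.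
      by apply: le_trans (_ : u - w <= _); [rewrite ger_pMr|]; lra.
    nra.
  have [v hv rd] := gd t ltac:(by rewrite at_ tb).
  have [d' d'0 hd'] := rd e e0.
  pose h := Num.min (Num.min d d' / 2) (b - t).
  have m0 : 0 < Num.min d d' by rewrite lt_min d0.
  have h0 : 0 < h by rewrite lt_min; apply/andP; split; lra.
  have h1 : h <= Num.min d d' / 2 by rewrite ge_min lexx.
  have h2 : h <= b - t by rewrite ge_min lexx orbT.
  have h3 : Num.min d d' <= d by rewrite ge_min lexx.
  have h4 : Num.min d d' <= d' by rewrite ge_min lexx orbT.
  exists h; split=> //; try lra.
  have h5 := hd' h h0 ltac:(lra) ltac:(lra).
  have h6 := nmB_le (g (t + h)) (g t).
  have h7 : nm (g (t + h) - g t) <= e * h + h * (L * nm (g t) + K).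
    apply: le_trans (_ : nm (g (t + h) - g t - h%:C *: v) + nm (h%:C *: v) <= _).
      by rewrite -{1}(subrK (h%:C *: v) (g (t + h) - g t)) nmD.
    by rewrite nmZr gtr0_norm //; apply: lerD => //; rewrite ler_wpM2l // ltW.
  have l0 := Lge _ at_; have l1 : L * (t + h - a) <= 2^-1 by apply: Lle; lra.
  rewrite /phi; have -> : t + h - a = t - a + h by ring.
  have Lh0 : 0 <= L * h by rewrite mulr_ge0 // ltW.
  have lE : L * (t - a + h) = L * (t - a) + L * h by ring.
  have kE : K * (t - a + h) = K * (t - a) + K * h by ring.
  rewrite lE kE; have l2 : L * (t - a) + L * h <= 2^-1.
    by rewrite -lE; have := l1; rewrite (_ : t + h - a = t - a + h) //; ring.
  set u := nm (g t) in h6 h7 *; set w := nm (g (t + h)) in h6 *.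
  have u0 : 0 <= u := nm_ge0 _.
  set l := L * (t - a) in l0 l2 *; set m := L * h in Lh0 l2 *.
  have q0 : 0 <= 1 - (l + m) by lra.
  have eh : 0 <= e * h by rewrite mulr_ge0 // ltW.
  have hE : h * (L * u + K) = m * u + K * h by rewrite /m; ring.
  have Kh : 0 <= K * h by rewrite mulr_ge0 // ltW.
  have h8 : w <= u + (e * h + m * u + K * h) by lra.
  (* The growth [m * u] of the norm is cancelled by the loss of weight in
     [u * (1 - (l + m)) = u * (1 - l) - m * u]. *)
  have h9 : w * (1 - (l + m)) <= (u + (e * h + m * u + K * h)) * (1 - (l + m)).
    by rewrite ler_wpM2r.
  have mu : 0 <= m * u by rewrite mulr_ge0.
  have h10 : (e * h + m * u + K * h) * (1 - (l + m)) <= e * h + m * u + K * h.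
    by rewrite ler_piMr ?addr_ge0 //; lra.
  have h11 : u * (1 - (l + m)) = u * (1 - l) - m * u by ring.
  have h12 : (u + (e * h + m * u + K * h)) * (1 - (l + m)) =
    u * (1 - (l + m)) + (e * h + m * u + K * h) * (1 - (l + m)) by ring.
  lra.
rewrite /phi subrr !mulr0 !subr0 mulr1 => h.
have : nm (g b) * 2^-1 <= nm (g b) * (1 - L * (b - a)).
  by rewrite ler_wpM2l ?nm_ge0 //; lra.
lra.
Qed.

End RealLine.

Lemma subrACA (U : zmodType) (a b c d : U) : (a - b) - (c - d) = (a - c) - (b - d).
Proof. by rewrite !opprD !opprK addrACA. Qed.

(** * Calculus of one-sided derivatives *)

Section RightDer.
Variables (R : realType) (W : normedModType R[i]).

Lemma right_derB (f g : R -> W) t b u v : right_der f t b u -> right_der g t b v ->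
  right_der (fun s => f s - g s) t b (u - v).
Proof.
move=> hf hg e e0; have e2 : 0 < e / 2 by rewrite divr_gt0.
have [d d0 hd] := hf _ e2; have [d' d'0 hd'] := hg _ e2.
exists (Num.min d d') => [|h h0]; first by rewrite lt_min d0.
rewrite lt_min => /andP[h1 h2] tb.
have -> : f (t + h) - g (t + h) - (f t - g t) - h%:C *: (u - v) =
  (f (t + h) - f t - h%:C *: u) - (g (t + h) - g t - h%:C *: v).
  by rewrite scalerBr (subrACA (f (t + h))) (subrACA (f (t + h) - f t)).
apply: le_trans (nmB _ _) _; have := hd _ h0 h1 tb; have := hd' _ h0 h2 tb; lra.
Qed.

Lemma right_derZ (f : R -> W) t b u (a : R[i]) : right_der f t b u ->
  right_der (fun s => a *: f s) t b (a *: u).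
Proof.
move=> hf e e0; have a1 : 0 < nm a + 1 by rewrite ltr_wpDl ?nm_ge0.
have [d d0 hd] := hf (e / (nm a + 1)) ltac:(by rewrite divr_gt0).
exists d => // h h0 h1 tb.
rewrite scalerA mulrC -scalerA -!scalerBr nmZ.
have := hd _ h0 h1 tb; rewrite mulrAC ler_pdivlMr // => hh.
apply: le_trans hh; rewrite mulrC ler_wpM2l ?nm_ge0 //; lra.
Qed.

Lemma right_der_sub (f : R -> W) t b b' v : b' <= b -> right_der f t b v -> right_der f t b' v.
Proof.
move=> bb hf e e0; have [d d0 hd] := hf e e0; exists d => // h h0 h1 tb.
by apply: hd => //; lra.
Qed.

Lemma lip_left_cont (f : R -> W) (a t K : R) : 0 <= K ->
  (forall s, a <= s <= t -> nm (f t - f s) <= K * (t - s)) -> left_cont f a t.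
Proof.
move=> K0 hf e e0; have K1 : 0 < K + 1 by lra.
exists (e / (K + 1)) => [|s st]; first by rewrite divr_gt0.
rewrite ltr_pdivlMr // => ts; apply: le_trans (hf _ st) _; apply: le_trans (ltW ts).
move: st => /andP[_ st]; rewrite mulrC ler_wpM2l ?subr_ge0 //; lra.
Qed.

Lemma left_contZ (f : R -> W) (a : R[i]) t0 t :
  left_cont f t0 t -> left_cont (fun s => a *: f s) t0 t.
Proof.
move=> hf e e0; have a1 : 0 < nm a + 1 by rewrite ltr_wpDl ?nm_ge0.
have [d d0 hd] := hf (e / (nm a + 1)) ltac:(by rewrite divr_gt0).
exists d => // s st sd; rewrite -scalerBr nmZ.
have := hd _ st sd; rewrite ler_pdivlMr // => hh; apply: le_trans hh.
by rewrite mulrC ler_wpM2l ?nm_ge0 //; lra.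
Qed.

Lemma left_contB (f g : R -> W) a t : left_cont f a t -> left_cont g a t ->
  left_cont (fun s => f s - g s) a t.
Proof.
move=> hf hg e e0; have e2 : 0 < e / 2 by rewrite divr_gt0.
have [d d0 hd] := hf _ e2; have [d' d'0 hd'] := hg _ e2.
exists (Num.min d d') => [|s st]; first by rewrite lt_min d0.
rewrite lt_min => /andP[h1 h2].
have -> : f t - g t - (f s - g s) = (f t - f s) - (g t - g s).
  by rewrite subrACA.
apply: le_trans (nmB _ _) _; have := hd _ st h1; have := hd' _ st h2; lra.
Qed.

End RightDer.

Section RowVectors.
Variables (R : realType) (n : nat).
Local Notation V := 'rV[R[i]]_n.

(* Restated so that addition in [V] is always that of matrices, which [lra]  *)
(* needs to identify norms syntactically.                                    *)
Let nmD (x y : V) : nm (x + y) <= nm x + nm y := nmD x y.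
Let nmB (x y : V) : nm (x - y) <= nm x + nm y := nmB x y.
Let nmDB (x y z : V) : nm (x - z) <= nm (x - y) + nm (y - z) := nmDB x y z.
Let nmBC (x y : V) : nm (x - y) = nm (y - x) := nmBC x y.
Let nmB_le (x y : V) : nm x - nm y <= nm (x - y) := nmB_le x y.

(* Bounded sets of [V] are relatively compact.                               *)
Lemma cauchy_limit (u : nat -> V) (x0 : V) (r : R) (a : nat -> R) :
  (forall i, nm (u i - x0) <= r) ->
  (forall e, 0 < e -> exists N, forall i, (N <= i)%N -> a i < e) ->
  (forall i j, (i <= j)%N -> nm (u i - u j) <= a i + a j) ->
  exists l, forall i, nm (u i - l) <= a i.
Proof.
move=> ur a0 ua.
have [|l [_ hl]] := @compact_nm_ball R n x0 r (u @ \oo) _.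
  by exists 0%N => // i _; exact: ur.
exists l => i; rewrite leNgt; apply/negP => h.
pose e := nm (u i - l) - a i; have e0 : 0 < e by rewrite subr_gt0.
have [N hN] := a0 (e / 2) ltac:(by rewrite divr_gt0).
have : (u @ \oo) (u @` [set j | (maxn i N <= j)%N]).
  by exists (maxn i N) => // j hj; exists j.
move=> /hl /(_ (_ : nbhs l [set y | nm (y - l) < e / 2])) [].
  by apply/nbhs_nm; exists (e / 2) => //; rewrite divr_gt0.
move=> _ [[j /= hj <-]] hjl.
have := ua i j ltac:(exact: leq_trans (leq_maxl _ _) hj).
have := hN j ltac:(exact: leq_trans (leq_maxr _ _) hj).
have := nmDB (u i) (u j) l; move: hjl; rewrite /e; lra.
Qed.

Lemma inv_nat_small (K e : R) : 0 <= K -> 0 < e ->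
  exists N, forall i, (N <= i)%N -> K / i.+1%:R < e.
Proof.
move=> K0 e0; exists (Num.truncn (K / e)) => i hi.
have i0 : 0 < i.+1%:R :> R by rewrite ltr0n.
have := truncnS_gt (K / e); rewrite ltr_pdivrMr // ltr_pdivrMr // => h.
apply: lt_le_trans h _; rewrite mulrC ler_pM2l // ler_nat.
by rewrite ltnS.
Qed.

(** * Local existence by Euler polygons *)

Section Euler.
Variables (F : V -> V) (x0 : V) (r B L : R).
Hypotheses (B0 : 0 < B) (L0 : 0 < L) (r0 : 0 < r).
Hypothesis FB : forall x : V, nm (x - x0) < r -> nm (F x) <= B.
Hypothesis FL : forall x y : V, nm (x - x0) < r -> nm (y - x0) < r ->
  nm (F y - F x) <= L * nm (y - x).
Variable tau : R.
Hypotheses (tau0 : 0 < tau) (tauB : B * tau <= r / 4) (tauL : L * tau <= 2^-1).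

Local Ltac slra := have := B0; have := L0; have := r0; have := tau0;
  have := tauB; have := tauL; lra.

(** The polygon with nodes at the multiples of [s]. Recursion on the number [k] of pieces leaves the
    earlier pieces unchanged, and the last piece is not cut off at time [k * s]. *)
Fixpoint euler (s : R) (x : V) (k : nat) (t : R) : V :=
  if k is k'.+1 then
    if t <= k'%:R * s then euler s x k' t
    else euler s x k' (k'%:R * s) +
         (t - k'%:R * s)%:C *: F (euler s x k' (k'%:R * s))
  else x.

(** [K] is the defect, the error allowed in the differential equation. *)
Definition approx_solution (y : R -> V) (x : V) (K b : R) :=
  [/\ y 0 = x,
      forall u t, 0 <= u -> u <= t -> t <= b -> nm (y t - y u) <= B * (t - u) &
      forall t, 0 <= t < b -> exists2 v, nm (v - F (y t)) <= K & right_der y t b v].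

Lemma approx_ball (y : R -> V) (x : V) (K b t : R) :
  approx_solution y x K b -> nm (x - x0) < r / 2 ->
  b <= tau -> 0 <= t <= b -> nm (y t - x0) < r.
Proof.
move=> [y0 yL _] xr bt /andP[t0 tb].
have := yL 0 t (lexx _) t0 tb; rewrite y0 subr0 => h.
have := nmDB (y t) x x0; have : B * t <= B * tau by rewrite ler_pM2l //; lra.
slra.
Qed.

(** On each piece the velocity is [F] at the preceding node, from which the curve is at most [B * s]
    away; hence the defect. *)
Lemma euler_approx (s : R) (x : V) (k : nat) : 0 < s -> k%:R * s <= tau ->
  nm (x - x0) < r / 2 -> approx_solution (euler s x k) x (L * (B * s)) (k%:R * s).
Proof.
move=> s0; elim: k => [_ xr|k IH].
  split=> // [u t u0 ut|t]; last by rewrite mul0r => /andP[t0 /(le_lt_trans t0)]; rewrite ltxx.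
  by rewrite mul0r => t0; rewrite subrr nm0 mulr_ge0 ?subr_ge0 // ltW.
have -> : k.+1%:R * s = k%:R * s + s by rewrite -addn1 natrD mulrDl mul1r.
move=> ks xr; have ks' : k%:R * s <= tau by lra.
have IHk := IH ks' xr; have [y0 yL yd] := IHk.
set c := k%:R * s in ks ks' IHk y0 yL yd *.
have c0 : 0 <= c by rewrite mulr_ge0 // ltW.
set p := euler s x k c in IHk y0 yL yd *.
have pr : nm (p - x0) < r by apply: approx_ball IHk _ _ _ => //; rewrite c0 lexx.
have eE t : euler s x k.+1 t = if t <= c then euler s x k t else p + (t - c)%:C *: F p by [].
have eE2 t : c <= t -> euler s x k.+1 t = p + (t - c)%:C *: F p.
  rewrite eE; case: (leP t c) => // tc ct; have -> : t = c by apply/eqP; rewrite eq_le tc ct.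
  by rewrite subrr scale0r addr0.
have lip2 u t : c <= u -> u <= t -> nm (euler s x k.+1 t - euler s x k.+1 u) <= B * (t - u).
  move=> cu ut; rewrite !eE2 //; last lra.
  rewrite opprD addrACA subrr add0r -scalerBl -rmorphB /= nmZr.
  have -> : t - c - (u - c) = t - u by ring.
  by rewrite ger0_norm ?subr_ge0 // mulrC ler_wpM2r ?subr_ge0 // FB.
split.
- by rewrite eE c0.
- move=> u t u0 ut tb; have [tc|ct] := leP t c.
    by rewrite !eE tc (le_trans ut tc); exact: yL.
  have [cu|uc] := leP c u; first exact: lip2.
  apply: le_trans (nmDB _ (euler s x k.+1 c) _) _.
  have h1 := lip2 c t (lexx _) (ltW ct).
  have h2 : nm (euler s x k.+1 c - euler s x k.+1 u) <= B * (c - u).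
    by rewrite !eE lexx (ltW uc); apply: yL => //; exact: ltW.
  have -> : B * (t - u) = B * (t - c) + B * (c - u) by ring.
  exact: lerD.
move=> t /andP[t0 tb]; have [ct|tc] := leP c t.
  exists (F p).
    have tr : nm (euler s x k.+1 t - p) <= B * s.
      rewrite eE2 // addrC addKr nmZr ger0_norm ?subr_ge0 //.
      apply: le_trans (_ : (t - c) * B <= _).
        by rewrite ler_wpM2l ?subr_ge0 // FB.
      by rewrite mulrC ler_pM2l //; lra.
    rewrite nmBC; apply: le_trans (FL pr _) _; last by rewrite ler_pM2l.
    apply: le_lt_trans (nmDB _ p _) _.
    have h1 : nm (p - x0) <= nm (x - x0) + B * c.
      apply: le_trans (nmDB _ x _) _; rewrite addrC lerD2l.
      by have := yL 0 c (lexx _) c0 (lexx _); rewrite y0 subr0.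
    have : B * (c + s) <= B * tau by rewrite ler_pM2l.
    rewrite mulrDr; slra.
  move=> e e0; exists 1 => // h h0 _ hb; rewrite !eE2 //; last lra.
  rewrite opprD addrACA subrr add0r -scalerBl -rmorphB /=.
  have -> : t + h - c - (t - c) = h by ring.
  by rewrite subrr nm0 mulr_ge0 // ltW.
have [v hv rd] := yd t ltac:(by rewrite t0 tc).
exists v; first by rewrite eE (ltW tc).
move=> e e0; have [d d0 hd] := rd e e0.
exists (Num.min d (c - t)) => [|h h0]; first by rewrite lt_min d0 subr_gt0.
rewrite lt_min => /andP[hd' hc] _.
have hc' : t + h <= c by lra.
by rewrite !eE hc' (ltW tc); exact: hd.
Qed.

(** Gronwall's inequality for the difference of the curves, in which the two defects add up. *)
Lemma approx_compare (y1 y2 : R -> V) (x1 x2 : V) (K1 K2 b t : R) : approx_solution y1 x1 K1 b ->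
  approx_solution y2 x2 K2 b -> nm (x1 - x0) < r / 2 -> nm (x2 - x0) < r / 2 ->
  b <= tau -> 0 <= K1 -> 0 <= K2 -> 0 <= t <= b ->
  nm (y1 t - y2 t) <= 2 * (nm (x1 - x2) + (K1 + K2) * t).
Proof.
move=> h1 h2 x1r x2r bt K10 K20 /andP[t0 tb].
have [y10 y1L y1d] := h1; have [y20 y2L y2d] := h2.
have := @gronwall R V (fun t => y1 t - y2 t) 0 t L (K1 + K2) t0 (ltW L0).
rewrite y10 y20 !subr0; apply.
- exact: addr_ge0.
- apply: le_trans tauL; rewrite ler_pM2l //; lra.
- move=> u /andP[u0 ut]; apply: left_contB; apply: (lip_left_cont (ltW B0)) => s /andP[s0 su].
    by apply: y1L => //; lra.
  by apply: y2L => //; lra.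
- move=> u /andP[u0 ut]; have ub : 0 <= u < b by rewrite u0; lra.
  have [v1 v1K d1] := y1d u ub; have [v2 v2K d2] := y2d u ub.
  exists (v1 - v2); last by apply: right_der_sub (right_derB d1 d2).
  have ub' : 0 <= u <= b by rewrite u0; lra.
  have := FL (approx_ball h2 x2r bt ub') (approx_ball h1 x1r bt ub').
  have -> : v1 - v2 = (v1 - F (y1 u)) - (v2 - F (y2 u)) + (F (y1 u) - F (y2 u)).
    by apply/rowP => i; rewrite !mxE; ring.
  move=> hF; apply: le_trans (nmD _ _) _; rewrite addrC; apply: lerD => //.
  by apply: le_trans (nmB _ _) _; exact: lerD.
Qed.

(** Gronwall's inequality with Lipschitz constant [0], for the curve minus the line through [y s]
    with velocity [F (y s)]: the velocities differ by at most the defect plus [L] times the distance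
    travelled. *)
Lemma approx_increment (y : R -> V) (x : V) (K b s t : R) : approx_solution y x K b ->
  nm (x - x0) < r / 2 -> b <= tau -> 0 <= K -> 0 <= s -> s <= t -> t <= b ->
  nm (y t - y s - (t - s)%:C *: F (y s)) <= 2 * ((K + L * (B * (t - s))) * (t - s)).
Proof.
move=> h xr bt K0 s0 st tb; have [y0 yL yd] := h.
pose g u := y u - y s - (u - s)%:C *: F (y s).
have sr : nm (y s - x0) < r by apply: (approx_ball h xr bt); rewrite s0; lra.
have ts : 0 <= t - s by rewrite subr_ge0.
have := @gronwall R V g s t 0 (K + L * (B * (t - s))) st (lexx _).
have -> : g s = 0 by rewrite /g !subrr scale0r subr0.
rewrite mul0r nm0 add0r; apply.
- by rewrite addr_ge0 // mulr_ge0 ?mulr_ge0 // ltW.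
- by rewrite invr_ge0.
- move=> u /andP[su ut]; apply: (@lip_left_cont _ _ _ _ _ (B + B)).
    by rewrite addr_ge0 // ltW.
  move=> w /andP[sw wu].
  have -> : g u - g w = (y u - y w) - (u - w)%:C *: F (y s).
    have -> : u - w = (u - s) - (w - s) by ring.
    by rewrite rmorphB /= scalerBl /g; apply/rowP => i; rewrite !mxE; ring.
  apply: le_trans (nmB _ _) _; rewrite nmZr ger0_norm ?subr_ge0 //.
  rewrite [leRHS]mulrDl; apply: lerD; first by apply: yL => //; lra.
  by rewrite mulrC ler_wpM2r ?subr_ge0 // FB.
- move=> u /andP[su ut]; have ub : 0 <= u < b by apply/andP; split; lra.
  have [v vK vd] := yd u ub; exists (v - F (y s)).
    have ur : nm (y u - x0) < r.
      by apply: (approx_ball h xr bt); rewrite (le_trans s0 su) (le_trans (ltW ut) tb).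
    have h1 := FL sr ur.
    have h2 : L * nm (y u - y s) <= L * (B * (t - s)).
      rewrite ler_pM2l //; apply: le_trans (yL s u s0 su (le_trans (ltW ut) tb)) _.
      by rewrite ler_pM2l // lerD2r ltW.
    apply: le_trans (nmDB v (F (y u)) (F (y s))) _; rewrite mul0r add0r.
    exact: lerD vK (le_trans h1 h2).
  move=> e e0; have [d d0 hd] := vd e e0; exists d => // w w0 wd wt.
  have := hd w w0 wd (le_trans wt tb).
  have -> : g (u + w) - g u - w%:C *: (v - F (y s)) = y (u + w) - y u - w%:C *: v.
    have -> : w = (u + w - s) - (u - s) by ring.
    rewrite rmorphB /= /g.
    have -> : u + (u + w - s - (u - s)) = u + w by ring.
    by apply/rowP => i; rewrite !mxE; ring.
  by [].
Qed.

(** The polygons with step [tau / N.+1] form a uniform Cauchy sequence, and their increment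
    estimates pass to the limit, where the defect disappears. A quadratic estimate for times in
    either order expresses the equation without derivatives. *)
Lemma exact_solution (x : V) : nm (x - x0) < r / 2 -> exists y : R -> V,
  [/\ y 0 = x,
      forall t, 0 <= t <= tau -> nm (y t - x0) < r &
      forall s t, 0 <= s <= tau -> 0 <= t <= tau ->
      nm (y t - y s - (t - s)%:C *: F (y s)) <= 3 * L * B * (t - s) ^+ 2].
Proof.
move=> xr.
pose st N : R := tau / N.+1%:R.
have N0 N : 0 < N.+1%:R :> R by rewrite ltr0n.
have stE N : N.+1%:R * st N = tau by rewrite /st mulrC divfK // gt_eqF.
have st0 N : 0 < st N by rewrite divr_gt0.
pose y N := euler (st N) x N.+1.
have yA N : approx_solution (y N) x (L * (B * st N)) tau.
  by rewrite -[X in approx_solution _ _ _ X](stE N); apply: euler_approx; rewrite ?stE.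
pose K N := L * (B * st N).
have K0 N : 0 <= K N by rewrite !mulr_ge0 // ltW.
pose a N := 2 * tau * L * B * tau / N.+1%:R.
have aE N : a N = 2 * (K N * tau) by rewrite /a /K /st; ring.
have a0 e : 0 < e -> exists N, forall i, (N <= i)%N -> a i < e.
  by apply: inv_nat_small; rewrite !mulr_ge0 // ltW.
have hy t : 0 <= t <= tau -> exists l, forall N, nm (y N t - l) <= a N.
  move=> t0t; apply: (@cauchy_limit (fun N => y N t) x0 r) => // [i|i j _].
    by apply: ltW; apply: (approx_ball (yA i)).
  apply: le_trans (approx_compare (yA i) (yA j) xr xr (lexx _) (K0 i) (K0 j) t0t) _.
  rewrite subrr nm0 add0r !aE -/(K i) -/(K j).
  have -> : 2 * (K i * tau) + 2 * (K j * tau) = 2 * ((K i + K j) * tau) by ring.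
  by rewrite ler_pM2l // ler_wpM2l ?addr_ge0 //; move/andP: t0t => [].
have [f fP] : exists f : R -> V, forall t, 0 <= t <= tau -> forall N, nm (y N t - f t) <= a N.
  have h t : exists l, 0 <= t <= tau -> forall N, nm (y N t - l) <= a N.
    have [t0t|nt] := boolP (0 <= t <= tau); last by exists 0.
    by have [l hl] := hy t t0t; exists l.
  by have [f fP] := choice h; exists f => t; exact: fP.
have small (u w : R) (c : R) : 0 <= c -> (forall N, u <= w + c * a N) -> u <= w.
  move=> c0 hu; rewrite leNgt; apply/negP => wu.
  have c1 : 0 < c + 1 by lra.
  have [N /(_ N (leqnn _)) hN] := a0 ((u - w) / (c + 1)) ltac:(by rewrite divr_gt0 ?subr_gt0).
  move: hN; rewrite ltr_pdivlMr // mulrC mulrDl mul1r => hN.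
  have : 0 <= a N by rewrite aE !mulr_ge0 // ltW.
  have := hu N; lra.
have f0 : f 0 = x.
  have y0 N : y N 0 = x by have [] := yA N.
  apply/eqP; rewrite -subr_eq0; apply/eqP/nm_eq0/le_anti; rewrite nm_ge0 andbT.
  apply: (small _ _ 1) => // N; rewrite add0r mul1r nmBC -(y0 N); apply: fP.
  by rewrite lexx ltW.
have fball t : 0 <= t <= tau -> nm (f t - x0) < r.
  move=> t0t; apply: le_lt_trans (_ : nm (x - x0) + r / 4 < r); last slra.
  apply: (small _ _ 1) => // N; rewrite mul1r.
  have [y0 yL _] := yA N; move/andP: (t0t) => [t0 tt].
  have := yL 0 t (lexx _) t0 tt; rewrite y0 subr0 => h1.
  have h2 : B * t <= B * tau by rewrite ler_pM2l.
  have := fP t t0t N; rewrite nmBC => h3.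
  apply: le_trans (nmDB _ (y N t) _) _; rewrite addrC; apply: lerD h3.
  apply: le_trans (nmDB _ x _) _; rewrite addrC lerD2l.
  exact: le_trans h1 (le_trans h2 tauB).
have fwd s t : 0 <= s <= tau -> 0 <= t <= tau -> s <= t ->
    nm (f t - f s - (t - s)%:C *: F (f s)) <= 2 * L * B * (t - s) ^+ 2.
  move=> s0s t0t st'; have ts : 0 <= t - s by rewrite subr_ge0.
  apply: (small _ _ (2 + (t - s) * L + (t - s) / tau)).
    rewrite !addr_ge0 ?mulr_ge0 // ?invr_ge0 ltW //.
  move=> N; have hs := fP s s0s N; have ht := fP t t0t N.
  move/andP: (s0s) => [s0 _]; move/andP: (t0t) => [_ tt].
  have hinc := approx_increment (yA N) xr (lexx _) (K0 N) s0 st' tt.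
  have ysr : nm (y N s - x0) < r by apply: (approx_ball (yA N) xr).
  have hF := FL ysr (fball s s0s).
  rewrite nmBC in hs; have hF' : nm (F (f s) - F (y N s)) <= L * a N.
    by apply: le_trans hF _; rewrite ler_pM2l.
  have -> : f t - f s - (t - s)%:C *: F (f s) =
    (y N t - y N s - (t - s)%:C *: F (y N s)) - (y N t - f t) - (f s - y N s)
    - (t - s)%:C *: (F (f s) - F (y N s)).
    by apply/rowP => i; rewrite !mxE; ring.
  apply: le_trans (nmB _ _) _; rewrite nmZr ger0_norm //.
  have h1 := nmB (y N t - y N s - (t - s)%:C *: F (y N s) - (y N t - f t)) (f s - y N s).
  have h2 := nmB (y N t - y N s - (t - s)%:C *: F (y N s)) (y N t - f t).
  have h3 : (t - s) * nm (F (f s) - F (y N s)) <= (t - s) * (L * a N) by rewrite ler_wpM2l.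
  have h4 : 2 * ((L * (B * st N) + L * (B * (t - s))) * (t - s)) =
    (t - s) / tau * a N + 2 * L * B * (t - s) ^+ 2.
    rewrite aE /K; field; rewrite gt_eqF //.
  rewrite h4 in hinc.
  have h5 : (2 + (t - s) * L + (t - s) / tau) * a N =
     a N + a N + (t - s) * (L * a N) + (t - s) / tau * a N by ring.
  rewrite h5; apply: le_trans (lerD (le_trans h1 (lerD (le_trans h2 (lerD hinc ht)) hs)) h3) _.
  by rewrite le_eqVlt; apply/orP; left; apply/eqP; ring.
have fL s t : 0 <= s <= tau -> 0 <= t <= tau -> s <= t -> nm (f t - f s) <= B * (t - s).
  move=> s0s t0t st'; apply: (small _ _ 2) => // N.
  have hs := fP s s0s N; have ht := fP t t0t N; rewrite nmBC in ht.
  have [_ yL _] := yA N; move/andP: (s0s) => [s0 _]; move/andP: (t0t) => [_ tt].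
  apply: le_trans (nmDB _ (y N t) _) _.
  apply: le_trans (lerD ht (le_trans (nmDB _ (y N s) _) (lerD (yL s t s0 st' tt) hs))) _.
  by rewrite le_eqVlt; apply/orP; left; apply/eqP; ring.
exists f; split=> // s t s0s t0t.
have LB0 : 0 <= L * B by rewrite mulr_ge0 // ltW.
have sq0 : 0 <= L * B * (t - s) ^+ 2 by rewrite mulr_ge0 // sqr_ge0.
(* Backwards in time the velocity is known at the other end; moving it costs another
   [L * B * (t - s) ^+ 2], hence the constant 3. *)
have [st'|ts'] := leP s t; first by apply: le_trans (fwd _ _ s0s t0t st') _; lra.
have ts0 : 0 <= s - t by rewrite subr_ge0 ltW.
have h1 := fwd _ _ t0t s0s (ltW ts').
have h2 := FL (fball _ t0t) (fball _ s0s).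
have h3 := fL _ _ t0t s0s (ltW ts').
have h4 : L * nm (f s - f t) <= L * (B * (s - t)) by rewrite ler_pM2l.
have h5 : (s - t) * nm (F (f s) - F (f t)) <= (s - t) * (L * (B * (s - t))).
  by rewrite ler_wpM2l //; lra.
have -> : f t - f s - (t - s)%:C *: F (f s) =
    (s - t)%:C *: (F (f s) - F (f t)) - (f s - f t - (s - t)%:C *: F (f t)).
  by rewrite !rmorphB /=; apply/rowP => i; rewrite !mxE; ring.
apply: le_trans (nmB _ _) _; rewrite nmZr ger0_norm //.
have -> : 3 * L * B * (t - s) ^+ 2 = (s - t) * (L * (B * (s - t))) + 2 * L * B * (s - t) ^+ 2.
  by ring.
lra.
Qed.

End Euler.

(** * From approximately linear to linear maps *)

Lemma le0_half_large (a b : R) (J : nat) : 0 <= b ->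
  (forall j, (J <= j)%N -> a <= b / 2 ^+ j) -> a <= 0.
Proof.
move=> b0 h; apply: (@le0_half _ _ b) => j.
apply: le_trans (h (j + J)%N (leq_addl _ _)) _.
rewrite ler_wpM2l // lef_pV2 ?posrE ?exprn_gt0 //.
by rewrite ler_weXn2l ?ler1n // leq_addr.
Qed.

(* The derivative is the limit of the quotients [2 ^+ j * D (h / 2 ^+ j)].   *)
Lemma approx_linear (D : V -> V) (rho C E : R) : 0 < rho -> 0 <= C -> 0 <= E ->
  D 0 = 0 -> (forall h : V, nm h < rho -> nm (D h) <= E * nm h) ->
  (forall (h k : V) (a : R[i]), nm h < rho -> nm k < rho -> nm (h + a *: k) < rho ->
    nm (D (h + a *: k) - D h - a *: D k) <=
      C * (nm (h + a *: k) ^+ 2 + nm h ^+ 2 + nm a * nm k ^+ 2)) ->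
  exists L : V -> V, [/\ linear L, forall h, nm (L h) <= E * nm h &
    forall h : V, nm h < rho -> nm (D h - L h) <= 2 * C * nm h ^+ 2].
Proof.
move=> rho0 C0 E0 D0 DE DA.
pose sc (j : nat) (h : V) : V := ((2 ^+ j : R)^-1)%:C *: h.
pose u (j : nat) (h : V) : V := (2 ^+ j : R)%:C *: D (sc j h).
have p0 j : 0 < 2 ^+ j :> R by rewrite exprn_gt0.
have nsc j h : nm (sc j h) = nm h / 2 ^+ j.
  by rewrite nmZr gtr0_norm ?invr_gt0 // mulrC.
have scr j h : nm h < 2 ^+ j * rho -> nm (sc j h) < rho.
  by rewrite nsc ltr_pdivrMr // mulrC.
pose b (j : nat) (h : V) : R := 2 * C * nm h ^+ 2 / 2 ^+ j.
have b0 j h : 0 <= b j h by rewrite /b divr_ge0 ?mulr_ge0 ?exprn_ge0 ?nm_ge0 // ltW.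
(* [DA] with first vector [0] and scalar [(2 ^+ (i - j))^-1] compares the quotients at two
   scales. *)
have uu i j h : (j <= i)%N -> nm h < 2 ^+ j * rho -> nm (u i h - u j h) <= b j h.
  move=> ji hj; pose a : R := (2 ^+ (i - j))^-1.
  have a0 : 0 < a by rewrite invr_gt0.
  have a1 : a <= 1 by rewrite invf_le1 // exprn_ege1 // ler1n.
  have ij : 2 ^+ i = 2 ^+ j * 2 ^+ (i - j) :> R by rewrite -exprD subnKC.
  have aE : 2 ^+ i * a = 2 ^+ j by rewrite ij /a mulfK // gt_eqF.
  have sE : sc i h = 0 + a%:C *: sc j h.
    by rewrite add0r /sc scalerA -rmorphM /= /a -invfM ij mulrC.
  have uE : u i h - u j h = (2 ^+ i : R)%:C *: (D (0 + a%:C *: sc j h) - D 0 - a%:C *: D (sc j h)).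
    by rewrite D0 subr0 -sE /u scalerBr scalerA -rmorphM /= aE.
  have n1 : nm (0 + a%:C *: sc j h) <= a * nm (sc j h).
    by rewrite add0r nmZr gtr0_norm.
  have h1 := scr _ _ hj.
  have n2 : a * nm (sc j h) <= nm (sc j h) by rewrite ler_piMl ?nm_ge0.
  have h2 : nm (0 + a%:C *: sc j h) < rho by lra.
  have := DA 0 (sc j h) a%:C; rewrite nm0 => /(_ rho0 h1 h2).
  rewrite (nm_real a) (gtr0_norm a0) expr0n /= addr0 => hD.
  rewrite uE nmZr (gtr0_norm (p0 i)).
  have sq : nm (0 + a%:C *: sc j h) ^+ 2 <= a * nm (sc j h) ^+ 2.
    apply: le_trans (_ : (a * nm (sc j h)) ^+ 2 <= _).
      by rewrite ler_pXn2r ?nnegrE ?mulr_ge0 ?nm_ge0 // ltW.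
    by rewrite exprMn ler_wpM2r ?exprn_ge0 ?nm_ge0 // expr2 ler_piMr // ltW.
  have h3 : nm (D (0 + a%:C *: sc j h) - D 0 - a%:C *: D (sc j h)) <=
      C * (2 * a * nm (sc j h) ^+ 2).
    apply: le_trans hD _; rewrite ler_wpM2l //.
    have -> : 2 * a * nm (sc j h) ^+ 2 = a * nm (sc j h) ^+ 2 + a * nm (sc j h) ^+ 2 by ring.
    by rewrite lerD2r.
  apply: le_trans (_ : 2 ^+ i * (C * (2 * a * nm (sc j h) ^+ 2)) <= _).
    by rewrite ler_pM2l.
  have -> : 2 ^+ i * (C * (2 * a * nm (sc j h) ^+ 2)) =
      2 * C * (2 ^+ i * a) * nm (sc j h) ^+ 2 by ring.
  rewrite aE nsc /b le_eqVlt; apply/orP; left; apply/eqP; field.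
  by rewrite gt_eqF.
have uE j h : nm h < 2 ^+ j * rho -> nm (u j h) <= E * nm h.
  move=> hj; rewrite nmZr gtr0_norm //.
  apply: le_trans (_ : 2 ^+ j * (E * nm (sc j h)) <= _).
    by rewrite ler_pM2l // DE // scr.
  by rewrite nsc le_eqVlt; apply/orP; left; apply/eqP; field; rewrite gt_eqF.
(* For short [h] the sequence starts at [j = 0], where the quotient is [D h] itself; for long [h]
   only those [j] count for which the rescaled vector is in the ball. *)
have hL h : exists l : V, (nm h < rho -> nm (D h - l) <= 2 * C * nm h ^+ 2) /\
    exists J, forall j, (J <= j)%N -> nm h < 2 ^+ j * rho /\ nm (u j h - l) <= b j h.
  have [J hJ hJ0] : exists2 J, forall j, (J <= j)%N -> nm h < 2 ^+ j * rho &
      (nm h < rho -> J = 0%N).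
    have [hr|hr] := ltP (nm h) rho.
      exists 0%N => // j _; apply: lt_le_trans hr _.
      by rewrite ler_pMl // exprn_ege1 // ler1n.
    by have [J hJ] := exp2_large (nm h) rho0; exists J => //; lra.
  have [|e e0|i j ij|l hl] := @cauchy_limit (fun i => u (i + J)%N h) 0 (E * nm h)
     (fun i => b (i + J)%N h).
  - by move=> i; rewrite subr0; apply: uE; apply: hJ; exact: leq_addl.
  - have [N hN] := exp2_large (2 * C * nm h ^+ 2) e0; exists N => i hi.
    by rewrite /b ltr_pdivrMr // [e * _]mulrC; apply: hN; rewrite (leq_trans hi) // leq_addr.
  - rewrite nmBC; apply: le_trans (uu _ _ _ _ _) _; [by rewrite leq_add2r| |].
      by apply: hJ; exact: leq_addl.
    by rewrite lerDl.
  exists l; split=> [hr|].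
    have := hl 0%N; rewrite /u /sc /b add0n (hJ0 hr) expr0 invr1 mulr1.
    by rewrite !rmorph1 !scale1r.
  exists J => j hj; split; first exact: hJ.
  by have := hl (j - J)%N; rewrite subnK.
have [L LP] := choice hL.
exists L; split.
- move=> a v w; rewrite (_ : a *: v + w = w + a *: v); last by rewrite addrC.
  rewrite (_ : a *: L v + L w = L w + a *: L v); last by rewrite addrC.
  apply/eqP; rewrite -subr_eq0; apply/eqP/nm_eq0/le_anti; rewrite nm_ge0 andbT.
  have [_ [J1 h1]] := LP (w + a *: v).
  have [_ [J2 h2]] := LP v.
  have [_ [J3 h3]] := LP w.
  pose T := 2 * C * nm (w + a *: v) ^+ 2 + 2 * C * nm w ^+ 2 + nm a * (2 * C * nm v ^+ 2)
    + C * (nm (w + a *: v) ^+ 2 + nm w ^+ 2 + nm a * nm v ^+ 2).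
  apply: (@le0_half_large _ T (J1 + J2 + J3)).
    by rewrite !addr_ge0 ?mulr_ge0 ?addr_ge0 ?mulr_ge0 ?exprn_ge0 ?nm_ge0.
  move=> j hj.
  have [r1 k1] := h1 j ltac:(by apply: leq_trans hj; rewrite -addnA leq_addr).
  have [r2 k2] := h2 j ltac:(by apply: leq_trans hj; rewrite addnAC leq_addl).
  have [r3 k3] := h3 j ltac:(by apply: leq_trans hj; rewrite leq_addl).
  have scE : sc j (w + a *: v) = sc j w + a *: sc j v.
    by rewrite /sc scalerDr !scalerA mulrC.
  have s1 := scr _ _ r1; rewrite scE in s1.
  have := DA _ _ a (scr _ _ r3) (scr _ _ r2) s1; rewrite -scE !nsc => hD.
  have -> : L (w + a *: v) - (L w + a *: L v) =
    (u j w - L w) - (u j (w + a *: v) - L (w + a *: v)) + a *: (u j v - L v)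
    + (2 ^+ j : R)%:C *: (D (sc j (w + a *: v)) - D (sc j w) - a *: D (sc j v)).
    by rewrite /u; apply/rowP => i; rewrite !mxE; ring.
  have q1 : nm (a *: (u j v - L v)) <= nm a * b j v by rewrite nmZ ler_wpM2l ?nm_ge0.
  have q2 : nm ((2 ^+ j : R)%:C *: (D (sc j (w + a *: v)) - D (sc j w) - a *: D (sc j v))) <=
      C * (nm (w + a *: v) ^+ 2 + nm w ^+ 2 + nm a * nm v ^+ 2) / 2 ^+ j.
    rewrite nmZr gtr0_norm // -ler_pdivlMl //; apply: le_trans hD _.
    by rewrite le_eqVlt; apply/orP; left; apply/eqP; field; rewrite gt_eqF.
  set X := u j w - L w in k3 *; set Y := u j (w + a *: v) - _ in k1 *.
  set Z := a *: (u j v - L v) in q1 *; set W := _ *: (D _ - _ - _) in q2 *.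
  have TE : T / 2 ^+ j = b j (w + a *: v) + b j w + nm a * b j v +
     C * (nm (w + a *: v) ^+ 2 + nm w ^+ 2 + nm a * nm v ^+ 2) / 2 ^+ j.
    by rewrite /T /b; field; rewrite gt_eqF.
  rewrite TE.
  apply: le_trans (nmD _ _) (lerD _ q2); apply: le_trans (nmD _ _) (lerD _ q1).
  by rewrite [b j (w + _) + _]addrC; exact: le_trans (nmB _ _) (lerD k3 k1).
- move=> h; have [_ [J hJ]] := LP h; rewrite -subr_le0.
  apply: (@le0_half_large _ (2 * C * nm h ^+ 2) J).
    by rewrite ?mulr_ge0 ?exprn_ge0 ?nm_ge0.
  move=> j /hJ[r1 k1]; have := uE _ _ r1; rewrite nmBC in k1.
  have := nmDB (L h) (u j h) 0; rewrite !subr0; move: k1; rewrite /b; lra.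
- by move=> h hr; have [h1 _] := LP h; apply: h1.
Qed.

(** * Complex differentiability of the flow *)

Section Flow.

Definition solution (F : V -> V) (x0 : V) (r K b : R) (y : R -> V) :=
  (forall t, 0 <= t <= b -> nm (y t - x0) < r) /\
  forall s t, 0 <= s <= b -> 0 <= t <= b ->
    nm (y t - y s - (t - s)%:C *: F (y s)) <= K * (t - s) ^+ 2.

Lemma solution_right_der F x0 r K b b' (y : R -> V) t : 0 <= K -> solution F x0 r K b y ->
  0 <= t -> t < b' -> b' <= b -> right_der y t b' (F (y t)).
Proof.
move=> K0 [yr yK] t0 tb bb e e0; have K1 : 0 < K + 1 by lra.
exists (e / (K + 1)) => [|h h0]; first by rewrite divr_gt0.
rewrite ltr_pdivlMr // => he thb.
have := yK t (t + h) ltac:(by rewrite t0; lra) ltac:(apply/andP; split; lra).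
have -> : t + h - t = h by ring.
move=> hh; apply: le_trans hh _; rewrite expr2 mulrA ler_pM2r //.
by move: he; rewrite mulrDr; lra.
Qed.

Lemma solution_left_cont F x0 r K B b b' (y : R -> V) t : 0 <= K -> 0 <= B ->
  (forall x : V, nm (x - x0) < r -> nm (F x) <= B) ->
  solution F x0 r K b y -> t <= b' -> b' <= b -> left_cont y 0 t.
Proof.
move=> K0 B0 FB [yr yK] tb bb.
apply: (@lip_left_cont _ _ _ _ _ (K * `|b| + B)); first by rewrite addr_ge0 // mulr_ge0.
move=> s /andP[s0 st]; have sb : 0 <= s <= b by apply/andP; split; lra.
have := yK s t sb ltac:(apply/andP; split; lra).
have := FB _ (yr _ sb) => hB hK; have ts : 0 <= t - s by lra.
have h1 : (t - s) * nm (F (y s)) <= B * (t - s) by rewrite mulrC ler_wpM2r.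
have h2 : K * (t - s) ^+ 2 <= K * `|b| * (t - s).
  rewrite expr2 mulrA ler_wpM2r // ler_wpM2l //.
  by apply: le_trans (ler_norm _); lra.
have := nmDB (y t - y s) ((t - s)%:C *: F (y s)) 0; rewrite !subr0 nmZr ger0_norm //.
lra.
Qed.

Variables (F : V -> V) (x0 : V) (r B L C tau K : R).
Hypotheses (B0 : 0 < B) (L0 : 0 < L) (C0 : 0 < C) (r0 : 0 < r) (K0 : 0 <= K).
Hypothesis FB : forall x : V, nm (x - x0) < r -> nm (F x) <= B.
Hypothesis FT : forall x y : V, nm (x - x0) < r -> nm (y - x0) < r ->
   [/\ nm (F y - F x) <= L * nm (y - x),
       nm (F y - F x - 'd F x (y - x)) <= C * nm (y - x) ^+ 2 &
       forall v : V, nm ('d F x v) <= L * nm v].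
Hypotheses (tau0 : 0 < tau) (tauL : L * tau <= 2^-1).

Lemma solution_compare y1 y2 t : solution F x0 r K tau y1 -> solution F x0 r K tau y2 ->
  0 <= t <= tau -> nm (y1 t - y2 t) <= 2 * nm (y1 0 - y2 0).
Proof.
move=> h1 h2 /andP[t0 tt]; have [y1r _] := h1; have [y2r _] := h2.
have := @gronwall R V (fun t => y1 t - y2 t) 0 t L 0 t0 (ltW L0) (lexx _).
rewrite !subr0 mul0r addr0; apply.
- by apply: le_trans tauL; rewrite ler_pM2l.
- move=> u /andP[_ ut]; apply: left_contB.
    exact: (solution_left_cont K0 (ltW B0) FB h1 ut tt).
  exact: (solution_left_cont K0 (ltW B0) FB h2 ut tt).
- move=> u /andP[u0 ut]; exists (F (y1 u) - F (y2 u)).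
    have ub : 0 <= u <= tau by rewrite u0; lra.
    by rewrite addr0; have [] := FT (y2r u ub) (y1r u ub).
  apply: right_derB; first exact: (solution_right_der K0 h1 u0 ut tt).
  exact: (solution_right_der K0 h2 u0 ut tt).
Qed.

(** The deviation [g] of the increments from linearity vanishes at time [0], and its velocity is
    ['d F (g s)] up to three Taylor remainders; Gronwall's inequality makes it quadratically small
    and [approx_linear] applies. The scalar [a] is complex, so the derivative is complex linear. *)
Lemma solution_diff (Y : R -> V -> V) (x : V) (t : R) :
  (forall x : V, nm (x - x0) < r / 2 -> Y 0 x = x /\ solution F x0 r K tau (Y ^~ x)) ->
  nm (x - x0) < r / 2 -> 0 <= t <= tau -> differentiable (Y t) x.
Proof.
move=> hY xr tt; pose rho := r / 2 - nm (x - x0).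
have rho0 : 0 < rho by rewrite subr_gt0.
have xh (h : V) : nm h < rho -> nm (x + h - x0) < r / 2.
  by move=> hr; rewrite addrAC; apply: le_lt_trans (nmD _ _) _; move: hr; rewrite /rho; lra.
have D2 (h : V) s : nm h < rho -> 0 <= s <= tau -> nm (Y s (x + h) - Y s x) <= 2 * nm h.
  move=> hr st; have [e1 s1] := hY _ (xh _ hr); have [e2 s2] := hY _ xr.
  by have := solution_compare s1 s2 st; rewrite e1 e2 [x + h]addrC addrK.
have [Yx Sx] := hY x xr.
pose D h := Y t (x + h) - Y t x.
(* A Taylor remainder is at most [C * (2 * nm q) ^+ 2], because increments grow at most by the
   factor 2; Gronwall's inequality contributes a further 2. *)
have C8 : 0 <= 8 * C * tau by rewrite !mulr_ge0 // ltW.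
have [|h hr|h k a hr kr har|Lin [Ll LE LD]] :=
  @approx_linear D rho (8 * C * tau) 2 rho0 C8 ltac:(by []).
- by rewrite /D addr0 subrr.
- exact: D2.
- pose g s := (Y s (x + (h + a *: k)) - Y s x) - (Y s (x + h) - Y s x) - a *: (Y s (x + k) - Y s x).
  have [Yhk Shk] := hY _ (xh _ har); have [Yh Sh] := hY _ (xh _ hr); have [Yk Sk] := hY _ (xh _ kr).
  pose Q := 4 * C * (nm (h + a *: k) ^+ 2 + nm h ^+ 2 + nm a * nm k ^+ 2).
  have Q0 : 0 <= Q by rewrite !mulr_ge0 ?addr_ge0 ?mulr_ge0 ?exprn_ge0 ?nm_ge0 // ltW.
  move/andP: (tt) => [t0 tle].
  have g0 : g 0 = 0.
    by rewrite /g Yhk Yh Yk Yx; apply/rowP => i; rewrite !mxE; ring.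
  have := @gronwall R V g 0 t L Q t0 (ltW L0) Q0; rewrite subr0 g0 nm0 add0r => hg.
  apply: le_trans (hg _ _ _) _.
  + by apply: le_trans tauL; rewrite ler_pM2l.
  + move=> s /andP[_ st]; have lc := fun y hy =>
      @solution_left_cont F x0 r K B tau t y s K0 (ltW B0) FB hy st tle.
    apply: left_contB; first by apply: left_contB; apply: left_contB; exact: lc.
    by apply: left_contZ; apply: left_contB; exact: lc.
  + move=> s /andP[s0 st]; have rd := fun y hy =>
      @solution_right_der F x0 r K tau t y s K0 hy s0 st tle.
    exists ((F (Y s (x + (h + a *: k))) - F (Y s x)) - (F (Y s (x + h)) - F (Y s x))
            - a *: (F (Y s (x + k)) - F (Y s x))); last first.
      apply: right_derB; first by apply: right_derB; apply: right_derB; exact: rd.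
      by apply: right_derZ; apply: right_derB; exact: rd.
    have sb : 0 <= s <= tau by rewrite s0; lra.
    have tay (q : V) : nm q < rho ->
       nm (F (Y s (x + q)) - F (Y s x) - 'd F (Y s x) (Y s (x + q) - Y s x)) <= 4 * C * nm q ^+ 2.
      move=> qr; have [_ Sq] := hY _ (xh _ qr).
      have [_ hT _] := FT (Sx.1 s sb) (Sq.1 s sb).
      apply: le_trans hT _; have -> : 4 * C * nm q ^+ 2 = C * (2 * nm q) ^+ 2 by ring.
      rewrite ler_pM2l // ler_pXn2r ?nnegrE ?mulr_ge0 ?nm_ge0 //.
      exact: D2.
    have [_ _ dL] := FT (Sx.1 s sb) (Sx.1 s sb).
    have t1 := tay _ har; have t2 := tay _ hr; have t3 := tay _ kr.
    have t4 := dL (g s).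
    set dF := 'd F (Y s x) in t1 t2 t3 t4 *.
    have gE : dF (g s) = dF (Y s (x + (h + a *: k)) - Y s x) - dF (Y s (x + h) - Y s x)
        - a *: dF (Y s (x + k) - Y s x).
      by rewrite /g linearB /= linearZ linearB.
    set A1 := dF (Y s (x + (h + a *: k)) - _) in gE t1.
    set A2 := dF (Y s (x + h) - _) in gE t2; set A3 := dF (Y s (x + k) - _) in gE t3.
    set F1 := F (Y s (x + (h + a *: k))) - F (Y s x) in t1 *.
    set F2 := F (Y s (x + h)) - F (Y s x) in t2 *.
    set F3 := F (Y s (x + k)) - F (Y s x) in t3 *.
    have -> : F1 - F2 - a *: F3 = dF (g s) + ((F1 - A1) - (F2 - A2) - a *: (F3 - A3)).
      by rewrite gE; apply/rowP => i; rewrite !mxE; ring.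
    have t5 : nm (a *: (F3 - A3)) <= nm a * (4 * C * nm k ^+ 2) by rewrite nmZ ler_wpM2l ?nm_ge0.
    have -> : Q = 4 * C * nm (h + a *: k) ^+ 2 + 4 * C * nm h ^+ 2 + nm a * (4 * C * nm k ^+ 2).
      by rewrite /Q; ring.
    apply: le_trans (nmD _ _) (lerD t4 _); apply: le_trans (nmB _ _) (lerD _ t5).
    exact: le_trans (nmB _ _) (lerD t1 t2).
  have -> : 8 * C * tau * (nm (h + a *: k) ^+ 2 + nm h ^+ 2 + nm a * nm k ^+ 2) = 2 * (Q * tau).
    by rewrite /Q; ring.
  by rewrite ler_pM2l // ler_wpM2l.
apply: (proj1 (diff_of_nm Ll LE _)) => e e0.
pose c := 2 * (8 * C * tau).
have c1 : 0 < c + 1 by rewrite /c; lra.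
exists (Num.min rho (e / (c + 1))) => [|h]; first by rewrite lt_min rho0 divr_gt0.
rewrite lt_min => /andP[hr]; rewrite ltr_pdivlMr // => he.
apply: le_trans (LD h hr) _; rewrite -/c expr2 mulrA ler_wpM2r ?nm_ge0 //.
by move: he; have := nm_ge0 h; rewrite mulrDr; lra.
Qed.

End Flow.

End RowVectors.

(** * Integral curves *)

Section Curves.
Variables (R : realType) (n : nat) (M : complexManifold R n).
Implicit Types (z w : M) (c d : chart R n M).
Local Notation V := 'rV[R[i]]_n.

Lemma within_dnbhs (A : set R) (t : R) (P : set R) : (within A t^') P <->
  exists2 d : R, 0 < d & forall s, A s -> `|s - t| < d -> s != t -> P s.
Proof.
split.
  move=> h; have /nbhs_real[d d0 hd] : nbhs t (fun s => s != t -> A s -> P s) by exact: h.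
  by exists d => // s As st sn; exact: hd.
move=> [d d0 hd]; suff : nbhs t (fun s => s != t -> A s -> P s) by [].
by apply/nbhs_real; exists d => // s st sn As; exact: hd.
Qed.

(** The difference quotient with its denominator cleared, in a single chart. *)
Definition chart_deriv (A : set R) (g : R -> M) (t : R) (z : M) (v : V) c :=
  forall e : R, 0 < e -> exists2 d : R, 0 < d &
    forall s, A s -> `|s - t| < d -> s != t ->
      chart_dom c (g s) /\ nm (c (g s) - c z - (s - t)%:C *: v) <= e * `|s - t|.

Lemma derivative_withinP A g t z (v : tangent z) c :
  derivative_within A g t v -> chart_at z c -> chart_deriv A g t z (v c) c.
Proof.
move=> [gz gd] cz e e0.
have [d1 d10 h1] : exists2 d : R, 0 < d &
    forall s, A s -> `|s - t| < d -> s != t -> chart_dom c (g s).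
  by apply/within_dnbhs; apply: gz; exact: chart_nbhs.
have [d2 d20 h2] : exists2 d : R, 0 < d & forall s, A s -> `|s - t| < d -> s != t ->
    nm (((s - t)^-1)%:C *: (c (g s) - c z) - v c) < e.
  apply/within_dnbhs; apply: (gd c cz [set x | nm (x - v c) < e]).
  by apply/nbhs_nm; exists e.
exists (Num.min d1 d2) => [|s As]; first by rewrite lt_min d10.
rewrite lt_min => /andP[s1 s2] st; split; first exact: h1.
have st0 : s - t != 0 by rewrite subr_eq0.
have -> : c (g s) - c z - (s - t)%:C *: v c =
   (s - t)%:C *: (((s - t)^-1)%:C *: (c (g s) - c z) - v c).
  by rewrite scalerBr scalerA -rmorphM /= divff // scale1r.
by rewrite nmZr mulrC ler_wpM2r // ltW // h2.
Qed.

(** In another chart the error splits into the remainder of the transition map and its differential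
    applied to the error in [c]; the tangent vector changes by the same differential. *)
Lemma derivative_within_chart A g t z (v : tangent z) c :
  chart_at z c -> chart_deriv A g t z (v c) c -> derivative_within A g t v.
Proof.
move=> cz hd.
have zz : chart_inv c (c z) = z by rewrite chart_mapK //; exact: (proj2 cz).
have lip (e : R) : 0 < e -> exists2 d : R, 0 < d &
    forall s, A s -> `|s - t| < d -> s != t -> chart_dom c (g s) /\
      nm (c (g s) - c z) < e /\ nm (c (g s) - c z) <= (1 + nm (v c)) * `|s - t|.
  move=> e0; have [d d0 h] := hd _ ltr01.
  have v1 : 0 < 1 + nm (v c) by rewrite ltr_wpDr ?nm_ge0.
  exists (Num.min d (e / (1 + nm (v c)))) => [|s As]; first by rewrite lt_min d0 divr_gt0.
  rewrite lt_min => /andP[s1 s2] st; have [dm hh] := h s As s1 st.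
  split=> //.
  have h1 : nm (c (g s) - c z) <= (1 + nm (v c)) * `|s - t|.
    have := nmB_le (c (g s) - c z) ((s - t)%:C *: v c); rewrite nmZr.
    by rewrite mulrDl [nm _ * _]mulrC; lra.
  split=> //; apply: le_lt_trans h1 _.
  by rewrite mulrC -ltr_pdivlMr.
split.
  move=> B hB.
  have /nbhs_nm[e e0 eB] : nbhs (c z) (fun x => B (chart_inv c x)).
    by apply: nbhs_preim; [apply: chart_inv_cont; exact: (proj2 cz)|rewrite zz].
  have [d d0 h] := lip e e0.
  apply/within_dnbhs; exists d => // s As sd st.
  have [dm [hs _]] := h s As sd st; by have := eB _ hs; rewrite chart_mapK.
move=> d dz B /nbhs_nm[e e0 eB].
have dif : differentiable (d \o chart_inv c) (c z).
  by case: cz dz => ? ? [? ?]; exact: atlas_compat.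
have vd : v d = 'd (d \o chart_inv c) (c z) (v c) by exact: tcoord_change.
have [C C0 hC] := diff_bounded dif.
have v1 : 0 < 1 + nm (v c) by rewrite ltr_wpDr ?nm_ge0.
pose e1 := e / (4 * (1 + nm (v c))); have e10 : 0 < e1 by rewrite divr_gt0 ?mulr_gt0.
have [d1 d10 h1] := diff_nm dif e10.
have [d2 d20 h2] := lip _ d10.
have [d3 d30 h3] := hd (e / (4 * C)) ltac:(by rewrite divr_gt0 ?mulr_gt0).
apply/within_dnbhs; exists (Num.min d2 d3) => [|s As]; first by rewrite lt_min d20.
rewrite lt_min => /andP[s2 s3] st; apply: eB.
have [dm [hs hs']] := h2 s As s2 st; have [_ hh] := h3 s As s3 st.
have st0 : s - t != 0 by rewrite subr_eq0.
have p0 : 0 < `|s - t| by rewrite normr_gt0.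
have := h1 (c (g s) - c z) hs.
rewrite subrKC /= chart_mapK // zz => k1.
have k2 : nm ('d (d \o chart_inv c) (c z) (c (g s) - c z - (s - t)%:C *: v c)) <=
    C * (e / (4 * C) * `|s - t|).
  by apply: le_trans (hC _) _; rewrite ler_pM2l.
have E : ((s - t)^-1)%:C *: (d (g s) - d z) - v d = ((s - t)^-1)%:C *:
   ((d (g s) - d z - 'd (d \o chart_inv c) (c z) (c (g s) - c z)) +
    'd (d \o chart_inv c) (c z) (c (g s) - c z - (s - t)%:C *: v c)).
  set dF := 'd _ _ in vd *; set X := c (g s) - c z.
  have -> : dF (X - (s - t)%:C *: v c) = dF X - (s - t)%:C *: v d.
    by rewrite vd linearB /= linearZ.
  set Z := d (g s) - d z.
  by rewrite addrA subrK [RHS]scalerBr scalerA -rmorphM /= mulVf // scale1r.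
rewrite E nmZr normfV ltr_pdivrMl //.
apply: le_lt_trans (nmD _ _) _.
have -> : `|s - t| * e = e / 4 * `|s - t| + e / 4 * `|s - t| + e / 2 * `|s - t| by field.
have k3 : e1 * nm (c (g s) - c z) <= e / 4 * `|s - t|.
  apply: le_trans (_ : e1 * ((1 + nm (v c)) * `|s - t|) <= _); first by rewrite ler_pM2l.
  by rewrite le_eqVlt; apply/orP; left; apply/eqP; rewrite /e1; field; rewrite gt_eqF.
have k4 : C * (e / (4 * C) * `|s - t|) = e / 4 * `|s - t| by field; rewrite gt_eqF.
rewrite k4 in k2.
apply: le_lt_trans (lerD (le_trans k1 k3) k2) _.
by rewrite ltrDl mulr_gt0 // divr_gt0.
Qed.

Variable H : forall z : M, tangent z.
Hypothesis hH : holomorphic_vector_field H.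
Hypothesis kd : is_distance (@kobayashi R n M).

Local Notation pos := [set s : R | 0 <= s].

Definition flows_at (g : R -> M) (t : R) := derivative_within pos g t (H (g t)).
Definition solves (g : R -> M) (T : R) := forall t, 0 <= t < T -> flows_at g t.

Lemma flows_chart g t c : flows_at g t -> chart_at (g t) c ->
  forall e : R, 0 < e -> exists2 d : R, 0 < d & forall s, 0 <= s -> `|s - t| < d ->
    chart_dom c (g s) /\
    nm (c (g s) - c (g t) - (s - t)%:C *: (H (g t) : chart R n M -> V) c) <= e * `|s - t|.
Proof.
move=> gt ct e e0; have [d d0 hd] := derivative_withinP gt ct e0.
exists d => // s s0 sd; have [->|st] := eqVneq s t; last exact: hd.
by rewrite !subrr scale0r subrr nm0 normr0 mulr0; split=> //; exact: (proj2 ct).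
Qed.

Lemma flows_cont g t (A : set M) : flows_at g t -> nbhs (g t) A ->
  exists2 d : R, 0 < d & forall s, 0 <= s -> `|s - t| < d -> A (g s).
Proof.
move=> [gt _] hA; have /within_dnbhs[d d0 hd] := gt A hA.
exists d => // s s0 sd; have [->|st] := eqVneq s t; last exact: hd.
exact: nbhs_singleton.
Qed.

Lemma flows_congr (f g : R -> M) t (d : R) : 0 < d -> 0 <= t ->
  (forall s, 0 <= s -> `|s - t| < d -> f s = g s) -> flows_at f t -> flows_at g t.
Proof.
move=> d0 t0 fg ft; have e : f t = g t by apply: fg => //; rewrite subrr normr0.
have [c cz] := exists_chart (g t).
apply: (derivative_within_chart cz) => eps eps0.
have cz' : chart_at (f t) c by rewrite e.
have [d1 d10 h] := flows_chart ft cz' eps0.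
exists (Num.min d d1) => [|s s0]; first by rewrite lt_min d0.
rewrite lt_min => /andP[sd sd1] _; have := h s s0 sd1.
by rewrite e (fg s).
Qed.

Lemma solves_shift g T s : 0 <= s -> solves g T -> solves (fun t => g (s + t)) (T - s).
Proof.
move=> s0 gT t /andP[t0 tT].
have [c cz] := exists_chart (g (s + t)).
apply: (derivative_within_chart cz) => e e0.
have [d d0 h] := flows_chart (gT (s + t) ltac:(apply/andP; split; lra)) cz e0.
exists d => // u /= u0 ud _; have E : s + u - (s + t) = u - t by ring.
by have := h (s + u); rewrite E => /(_ (addr_ge0 s0 u0) ud).
Qed.

Lemma solves_le g T T' : T' <= T -> solves g T -> solves g T'.
Proof. by move=> TT gT t /andP[t0 tT]; apply: gT; rewrite t0 (lt_le_trans tT). Qed.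

Lemma field_local z c : chart_at z c -> exists r B L C : R,
  [/\ 0 < r, [/\ 0 < B, 0 < L & 0 < C],
    (forall x : V, nm (x - c z) < r ->
    [/\ chart_dom c (chart_inv c x), c (chart_inv c x) = x &
        {for x, continuous (chart_inv c)}]),
    (forall x : V, nm (x - c z) < r -> nm ((H (chart_inv c x) : chart R n M -> V) c) <= B) &
    let F := fun x : V => (H (chart_inv c x) : chart R n M -> V) c in
    forall x y : V, nm (x - c z) < r -> nm (y - c z) < r ->
    [/\ nm (F y - F x) <= L * nm (y - x),
       nm (F y - F x - 'd F x (y - x)) <= C * nm (y - x) ^+ 2 &
       forall v : V, nm ('d F x v) <= L * nm v]].
Proof.
move=> cz; have [r0 r00 hr0] := chart_ball cz.
have [x xr|r [B [L [C [rp rr BLC hB hT]]]]] :=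
  @holo_local R n M z kd (fun x : V => (H (chart_inv c x) : chart R n M -> V) c) (c z) r0 r00.
  have [dx cx _] := hr0 x xr; rewrite -[X in differentiable _ X]cx.
  by apply: hH; split=> //; exact: (proj1 cz).
exists r, B, L, C; split=> // x xr; apply: hr0; exact: lt_le_trans xr rr.
Qed.

(** One time [tau] serves all starting points near [p]. This uniformity lets a curve be continued
    past its final time once it comes close to a limit point. *)
Lemma local_flow (p : M) : exists (U : set M) (tau : R) (Y : R -> M -> M),
  [/\ nbhs p U, 0 < tau & forall q, U q -> [/\ Y 0 q = q, solves (Y ^~ q) tau &
    forall t, 0 <= t < tau -> holo_at (Y t) q]].
Proof.
have [c cp] := exists_chart p.
have [r [B [L [C [r0 [B0 L0 C0] hr hB hT]]]]] := field_local cp.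
pose F := fun x : V => (H (chart_inv c x) : chart R n M -> V) c.
(* The first bound keeps curves from the half ball inside the ball, the second lets Gronwall's
   inequality run up to time [tau]. *)
pose tau := Num.min (r / (4 * B)) (1 / (2 * L)).
have tau0 : 0 < tau by rewrite lt_min !divr_gt0 ?mulr_gt0.
have tauB : B * tau <= r / 4.
  apply: le_trans (_ : B * (r / (4 * B)) <= _); first by rewrite ler_pM2l // ge_min lexx.
  by rewrite le_eqVlt; apply/orP; left; apply/eqP; field; rewrite gt_eqF.
have tauL : L * tau <= 2^-1.
  apply: le_trans (_ : L * (1 / (2 * L)) <= _); first by rewrite ler_pM2l // ge_min lexx orbT.
  by rewrite le_eqVlt; apply/orP; left; apply/eqP; field; rewrite gt_eqF.
have FL (x y : V) : nm (x - c p) < r -> nm (y - c p) < r -> nm (F y - F x) <= L * nm (y - x).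
  by move=> xr yr; have [] := hT x y xr yr.
have ex (x : V) : exists y : R -> V, nm (x - c p) < r / 2 ->
    y 0 = x /\ solution F (c p) r (3 * L * B) tau y.
  have [xr|xr] := ltP (nm (x - c p)) (r / 2); last by exists (fun _ => x).
  have [y [y0 yr yK]] := exact_solution B0 L0 r0 hB FL tau0 tauB tauL xr.
  by exists y.
have [Yx hYx] := choice ex.
pose Y t x := Yx x t.
have hY (x : V) : nm (x - c p) < r / 2 -> Y 0 x = x /\ solution F (c p) r (3 * L * B) tau (Y ^~ x).
  exact: hYx.
have K0 : 0 <= 3 * L * B by rewrite !mulr_ge0 // ltW.
exists [set q | chart_dom c q /\ nm (c q - c p) < r / 2], tau, (fun t q => chart_inv c (Y t (c q))).
split=> //.
  apply: filterI; first exact: chart_nbhs.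
  apply: (@nbhs_preim _ _ c p (fun x => nm (x - c p) < r / 2)).
    by apply: chart_map_cont; exact: (proj2 cp).
  by apply/nbhs_nm; exists (r / 2) => //; rewrite divr_gt0.
move=> q [dq qr]; have [Y0 [Yr YK]] := hY _ qr.
split.
- by rewrite Y0 chart_mapK.
- move=> t /andP[t0 tt]; have tb : 0 <= t <= tau by rewrite t0 ltW.
  have [dY cY _] := hr _ (Yr _ tb).
  have cz : chart_at (chart_inv c (Y t (c q))) c by split=> //; exact: (proj1 cp).
  apply: (derivative_within_chart cz) => e e0.
  have K1 : 0 < 3 * L * B + 1 by lra.
  exists (Num.min (tau - t) (e / (3 * L * B + 1))) => [|s /= s0].
    by rewrite lt_min subr_gt0 tt divr_gt0.
  rewrite lt_min => /andP[s1 s2] st.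
  have sb : 0 <= s <= tau by rewrite s0; have := ler_norm (s - t); lra.
  have [dYs cYs _] := hr _ (Yr _ sb); split=> //.
  rewrite cYs cY; have := YK _ _ tb sb => hK; apply: le_trans hK _.
  rewrite -real_normK ?num_real // expr2 mulrA ler_wpM2r //.
  by move: s2; rewrite ltr_pdivlMr // mulrDr; have := normr_ge0 (s - t); lra.
move=> t /andP[t0 tt] d dq'; have tb : 0 <= t <= tau by rewrite t0 ltW.
have qq : chart_inv d (d q) = q by rewrite chart_mapK //; exact: (proj2 dq').
apply: (@cdiff_inv _ _ _ _ (fun x => Y t (c (chart_inv d x))) _ p c r cp hr); last first.
  by rewrite qq; exact: Yr.
have d1 : differentiable (c \o chart_inv d) (d q).
  by case: dq' cp => ? ? [? ?]; exact: atlas_compat.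
apply: (differentiable_comp d1); rewrite /= qq.
exact: (solution_diff B0 L0 C0 K0 hB hT tau0 tauL hY qr tb).
Qed.

(** Gronwall's inequality in a chart, with no initial difference and no defect, for as long as both
    curves stay in the coordinate ball. *)
Lemma solves_unique_local g1 g2 T t : solves g1 T -> solves g2 T -> 0 <= t < T ->
  g1 t = g2 t -> exists2 d : R, 0 < d & forall s, t < s < t + d -> g1 s = g2 s.
Proof.
move=> s1 s2 tT e12; have [c cp] := exists_chart (g1 t).
have [r [B [L [C [r0 [B0 L0 C0] hr hB hT]]]]] := field_local cp.
pose W : set M := [set q | chart_dom c q /\ nm (c q - c (g1 t)) < r].
have nW : nbhs (g1 t) W.
  apply: filterI; first exact: chart_nbhs.
  apply: (@nbhs_preim _ _ c (g1 t) (fun x => nm (x - c (g1 t)) < r)).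
    by apply: chart_map_cont; exact: (proj2 cp).
  by apply/nbhs_nm; exists r.
have [d1 d10 h1] := flows_cont (s1 t tT) nW.
have nW' : nbhs (g2 t) W by rewrite -e12.
have [d2 d20 h2] := flows_cont (s2 t tT) nW'.
move/andP: (tT) => [t0 tT'].
pose d := Num.min (Num.min d1 d2) (Num.min (T - t) (1 / (2 * L))).
exists d => [|s /andP[ts sd]].
  by rewrite !lt_min d10 d20 subr_gt0 tT' divr_gt0 // mulr_gt0.
move: (sd); rewrite -ltrBlDl !lt_min => /andP[/andP[sd1 sd2] /andP[sT sL]].
have W12 u : t <= u <= s -> [/\ W (g1 u), W (g2 u), 0 <= u & u < T].
  move=> /andP[tu us]; have nu : `|u - t| <= s - t by rewrite ger0_norm; lra.
  by split; [apply: h1|apply: h2| |]; lra.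
have right_der_of g u : solves g T -> (forall u, t <= u <= s -> W (g u)) -> t <= u < s ->
    right_der (fun u => c (g u)) u s ((H (chart_inv c (c (g u))) : chart R n M -> V) c).
  move=> sg Wg /andP[tu us] e e0; have tus : t <= u <= s by rewrite tu ltW.
  have [_ _ u0 uT] := W12 u tus; have [dg _] := Wg u tus.
  have cu : chart_at (g u) c by split=> //; exact: (proj1 cp).
  have [d' d'0 hd'] := flows_chart (sg u ltac:(by rewrite u0 uT)) cu e0.
  exists d' => // h hh0 hd hs; rewrite chart_mapK //.
  have hE : u + h - u = h by ring.
  by have := hd' (u + h); rewrite hE gtr0_norm // => /(_ ltac:(lra) hd) [_].
have left_cont_of g u : solves g T -> (forall u, t <= u <= s -> W (g u)) -> t < u <= s ->
    left_cont (fun u => c (g u)) t u.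
  move=> sg Wg /andP[tu us] e e0; have tus : t <= u <= s by rewrite us ltW.
  have [_ _ u0 uT] := W12 u tus; have [dg _] := Wg u tus.
  have nn : nbhs (g u) (fun q => nm (c q - c (g u)) < e).
    apply: (@nbhs_preim _ _ c (g u) (fun x => nm (x - c (g u)) < e)).
      exact: chart_map_cont.
    by apply/nbhs_nm; exists e.
  have [d' d'0 hd'] := flows_cont (sg u ltac:(by rewrite u0 uT)) nn.
  exists d' => // v /andP[tv vu] uv; rewrite nmBC; apply: ltW; apply: hd'; first lra.
  by rewrite distrC ger0_norm; lra.
have W1 u : t <= u <= s -> W (g1 u) by move=> /W12[].
have W2 u : t <= u <= s -> W (g2 u) by move=> /W12[].
have := @gronwall R V (fun u => c (g1 u) - c (g2 u)) t s L 0 (ltW ts) (ltW L0) (lexx _).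
rewrite e12 subrr nm0 mul0r addr0 mulr0 => hg.
have : nm (c (g1 s) - c (g2 s)) <= 0.
  apply: hg.
  - have : L * (s - t) <= L * (1 / (2 * L)) by rewrite ler_pM2l // ltW.
    have -> : L * (1 / (2 * L)) = 2^-1 by field; rewrite gt_eqF.
    by [].
  - by move=> u tus; apply: left_contB; apply: left_cont_of.
  - move=> u tus; exists ((H (chart_inv c (c (g1 u))) : chart R n M -> V) c -
      (H (chart_inv c (c (g2 u))) : chart R n M -> V) c).
      rewrite addr0; have tus' : t <= u <= s by move/andP: tus => [-> /ltW->].
      by have [] := hT _ _ (proj2 (W2 u tus')) (proj2 (W1 u tus')).
    by apply: right_derB; apply: right_der_of.
move=> le0; have /nm_eq0 : nm (c (g1 s) - c (g2 s)) = 0 by apply/le_anti; rewrite le0 nm_ge0.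
move/subr0_eq => cE; have ss : t <= s <= s by rewrite lexx ltW.
by rewrite -(chart_mapK (proj1 (W1 _ ss))) cE chart_mapK //; exact: (proj1 (W2 _ ss)).
Qed.

Lemma solves_unique g1 g2 T t : solves g1 T -> solves g2 T -> g1 0 = g2 0 ->
  0 <= t < T -> g1 t = g2 t.
Proof.
move=> s1 s2 e0 /andP[t0 tT].
apply: (@real_ind R (fun s => g1 s = g2 s) 0 t t0 e0); last by rewrite t0 lexx.
- move=> s /andP[s0 st] hs.
  have [d d0 hd] := solves_unique_local s1 s2
    (ltac:(by rewrite s0; lra) : 0 <= s < T) (hs s ltac:(by rewrite s0 lexx)).
  by exists d => // u su _; exact: hd.
(* Equality passes to the limit from the left, because [M] is Hausdorff and both curves are
   continuous. *)
move=> s /andP[s0 st] hs.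
apply: (@mhausdorff R n M) => A B hA hB.
have sT : 0 <= s < T by apply/andP; split; lra.
have [d1 d10 h1] := flows_cont (s1 s sT) hA.
have [d2 d20 h2] := flows_cont (s2 s sT) hB.
pose d := Num.min (Num.min d1 d2) s.
have dp : 0 < d by rewrite !lt_min d10 d20.
have dd1 : d <= d1 by rewrite !ge_min lexx.
have dd2 : d <= d2 by rewrite !ge_min lexx orbT.
have ds : d <= s by rewrite !ge_min lexx orbT.
have us : 0 <= s - d / 2 < s by apply/andP; split; lra.
have nu : `|s - d / 2 - s| = d / 2.
  by rewrite (_ : _ - s = - (d / 2)) ?normrN ?gtr0_norm ?divr_gt0 //; ring.
exists (g1 (s - d / 2)); split; first by apply: h1; rewrite ?nu; lra.
by rewrite hs //; apply: h2; rewrite ?nu; lra.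
Qed.

(** Solutions agree on common times by uniqueness, so the curve can be assembled by choosing for
    every [t] a solution that reaches beyond [t]. *)
Lemma solves_glue z : exists G : R -> M, G 0 = z /\ forall t, 0 <= t ->
  (exists g T, [/\ g 0 = z, t < T & solves g T]) -> flows_at G t.
Proof.
have ex t : exists g : R -> M, (exists g T, [/\ g 0 = z, t < T & solves g T]) ->
    exists T, [/\ g 0 = z, t < T & solves g T].
  have [[g [T h]]|nh] := pselect (exists g T, [/\ g 0 = z, t < T & solves g T]).
    by exists g => _; exists T.
  by exists (fun _ => z).
have [gs hgs] := choice ex.
have key t g T : 0 <= t -> g 0 = z -> t < T -> solves g T -> gs t t = g t.
  move=> t0 g0 tT gT; have [T' [g0' tT' gT']] := hgs t ltac:(by exists g, T).
  apply: (@solves_unique _ _ (Num.min T T')); last by rewrite t0 lt_min tT tT'.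
  - by apply: solves_le gT'; rewrite ge_min lexx orbT.
  - by apply: solves_le gT; rewrite ge_min lexx.
  - by rewrite g0 g0'.
exists (fun t => gs t t); split.
  have [U [tau [Y [nU tau0 hY]]]] := local_flow z.
  have [Y0 sY _] := hY z (nbhs_singleton nU).
  by rewrite (key 0 (Y ^~ z) tau) //; rewrite lexx.
move=> t t0 [g [T [g0 tT gT]]].
apply: (@flows_congr g _ t (T - t)) => //; first by rewrite subr_gt0.
  move=> s s0 sT; rewrite (key s g T) //.
  by have := ler_norm (s - t); lra.
by apply: gT; rewrite t0 tT.
Qed.

(** The new curve changes from [G] to the translate of [g] at [T], although [g] starts at [t < T].
    The two agree in between, so near every time the curve is one of the two solutions and no corner
    has to be differentiated. *)
Lemma solves_concat G T g tau t : solves G T -> solves g tau -> 0 <= t < T ->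
  g 0 = G t -> exists G', G' 0 = G 0 /\ solves G' (t + tau).
Proof.
move=> GT gtau /andP[t0 tT] gG.
have agree s : t <= s -> s < T -> s < t + tau -> G s = g (s - t).
  move=> ts sT stau.
  have h1 := solves_shift t0 GT.
  have -> : G s = G (t + (s - t)) by congr G; ring.
  apply: (@solves_unique (fun u => G (t + u)) g (Num.min (T - t) tau)).
  - by apply: solves_le h1; rewrite ge_min lexx.
  - by apply: solves_le gtau; rewrite ge_min lexx orbT.
  - by rewrite addr0.
  - by rewrite lt_min; apply/and3P; split; lra.
exists (fun s => if s < T then G s else g (s - t)).
split; first by rewrite (le_lt_trans t0 tT).
move=> s /andP[s0 st]; have [sT|Ts] := ltP s T.
  apply: (@flows_congr G _ s (T - s)) => //; first by rewrite subr_gt0.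
    by move=> u u0 us; have -> : u < T by have := ler_norm (u - s); lra.
  by apply: GT; rewrite s0 sT.
have ts : t < s by lra.
apply: (@flows_congr (fun u => g (u - t)) _ s (Num.min (s - t) (t + tau - s))) => //.
- by rewrite lt_min !subr_gt0 ts st.
- move=> u u0; rewrite lt_min ltr_norml => /andP[/andP[h1 h2] h3].
  case: ltP => // uT; rewrite agree //; first lra.
  by have := ler_norm (u - s); lra.
have [c cz] := exists_chart (g (s - t)).
apply: (derivative_within_chart cz) => e e0.
have [d d0 h] := flows_chart (gtau (s - t) ltac:(apply/andP; split; lra)) cz e0.
exists (Num.min d (s - t)) => [|u /= u0]; first by rewrite lt_min d0 subr_gt0.
rewrite lt_min => /andP[ud ust] _; have E : u - t - (s - t) = u - s by ring.
have := h (u - t); rewrite E; apply => //.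
by move: ust; rewrite ltr_norml => /andP[]; lra.
Qed.

End Curves.

(** * Barth's theorem on the topology of the Kobayashi distance *)

Section Barth.
Variables (R : realType) (n : nat) (M : complexManifold R n).
Implicit Types (z w : M) (c d : chart R n M).
Local Notation V := 'rV[R[i]]_n.
Local Notation k := (@kobayashi R n M).
Hypothesis kd : is_distance k.

Lemma first_exit (P : set M) (p : nat -> M) (m : nat) : P (p 0%N) -> ~ P (p m) ->
  exists2 j, (j < m)%N & P (p j) /\ ~ P (p j.+1).
Proof.
move=> P0; elim: m => [//|m IH] Pm.
have [Pm'|Pm'] := pselect (P (p m)); first by exists m.
by have [j jm hj] := IH Pm'; exists j => //; exact: ltnW.
Qed.

(* A short chain of discs cannot cross a coordinate sphere, which has a      *)
(* positive distance to its centre; so [k] induces the topology of [M].      *)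
Lemma kob_topology z (A : set M) : nbhs z A ->
  exists2 e : R, 0 < e & forall w, k z w < e -> A w.
Proof.
move=> hA; have [c cz] := exists_chart z.
have [r [r0 hr ksep]] := kob_separated kd cz.
have zz : chart_inv c (c z) = z by rewrite chart_mapK //; exact: (proj2 cz).
have /nbhs_nm[r1 r10 r1A] : nbhs (c z) (fun x => A (chart_inv c x)).
  by apply: nbhs_preim; [apply: chart_inv_cont; exact: (proj2 cz)|rewrite zz].
pose rho := Num.min r r1; have rho0 : 0 < rho by rewrite lt_min r0.
have rr : rho <= r by rewrite ge_min lexx.
have rr1 : rho <= r1 by rewrite ge_min lexx orbT.
have [e e0 he] := ksep rho rho0.
pose W : set M := [set q | chart_dom c q /\ nm (c q - c z) < rho].
have WA q : W q -> A q.
  by move=> [dq hq]; rewrite -(chart_mapK dq); apply: r1A; exact: lt_le_trans hq rr1.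
have Wopen q : W q -> nbhs q W.
  move=> [dq hq]; have cq : chart_at q c by split=> //; exact: (proj1 cz).
  apply: filterI; first exact: chart_nbhs.
  apply: (@nbhs_preim _ _ c q (fun x => nm (x - c z) < rho)); first exact: chart_map_cont.
  apply/nbhs_nm; exists (rho - nm (c q - c z)); first by rewrite subr_gt0.
  by move=> y yq; have := nmDB y (c q) (c z); lra.
have ball2 (x : V) : nm (x - c z) <= rho -> nm (x - c z) < 2 * r by lra.
(* The closed coordinate ball is compact, hence closed in [M]: limits of points of [W] lie in [K],
   and if not in [W], on the sphere. *)
pose K : set M := chart_inv c @` [set x : V | nm (x - c z) <= rho].
have Kclosed : closed K.
  apply: compact_closed; first exact: mhausdorff.
  apply: continuous_compact; last exact: compact_nm_ball.
  apply: continuous_in_subspaceT => x; rewrite inE => /= xr.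
  by have [] := hr x (ball2 x xr).
have KW q : K q -> ~ W q -> chart_dom c q /\ nm (c q - c z) = rho.
  move=> [x /= xr <-]; have [dx cx _] := hr x (ball2 x xr).
  rewrite /W /= cx => h; split=> //; apply/le_anti; rewrite xr /= leNgt; apply/negP => lt.
  by apply: h.
have WK q : W q -> K q.
  by move=> [dq hq]; exists (c q); [exact: ltW|rewrite chart_mapK].
exists e => // w kzw; apply: contrapT => nAw.
have zw : z <> w by move=> E; apply: nAw; rewrite -E; exact: nbhs_singleton.
have nWw : ~ W w by move=> /WA.
have Wz : W z by split; [exact: (proj2 cz)|rewrite subrr nm0].
have [s [m [p [f [a [b [m0 p0 pm hch sE]]]]]] slt] := kob_lt_chain kd zw kzw.
have [j jm [Wj nWj]] : exists2 j, (j < m)%N & W (p j) /\ ~ W (p j.+1).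
  by apply: first_exit; rewrite ?p0 ?pm.
have [fh aj bj fa fb] := hch j jm; rewrite !unit_discE in aj bj.
(* A straight path in the disc of a link that leaves [W]. *)
pose sg (t : R) := a j + t%:C * (b j - a j).
have sg1 t : 0 <= t <= 1 -> nm (sg t) < 1 /\ poincare (a j) (sg t) <= poincare (a j) (b j).
  exact: poincare_segment.
have sgc t (B : set M) : 0 <= t <= 1 -> nbhs (f j (sg t)) B ->
    exists2 d : R, 0 < d & forall u, `|u - t| < d -> B (f j (sg u)).
  move=> t01 hB; have [h1 _] := sg1 t t01; rewrite -unit_discE in h1.
  have [fc _] := fh _ h1.
  have /nbhs_nm[d d0 hd] := nbhs_preim fc hB.
  have q0 : 0 < nm (b j - a j) + 1 by rewrite ltr_wpDl ?nm_ge0.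
  exists (d / (nm (b j - a j) + 1)) => [|u]; first by rewrite divr_gt0.
  rewrite ltr_pdivlMr // => ut; apply: hd.
  have -> : sg u - sg t = (u - t)%:C * (b j - a j).
    by rewrite /sg rmorphB /=; ring.
  rewrite nm_M nm_real; apply: le_lt_trans _ ut.
  by rewrite ler_wpM2l // lerDl.
have ksum i : (i <= m)%N -> k z (p i) <= \sum_(l < i) poincare (a l) (b l).
  elim: i => [_|i IH im]; first by rewrite big_ord0 p0 (kob_refl kd).
  apply: le_trans (kob_tri kd _ (p i) _) _; rewrite big_ord_recr /=.
  apply: lerD; first by apply: IH; exact: ltnW.
  by have [gh ga gb <- <-] := hch i im; apply: kob_disc; rewrite -?unit_discE.
have sum_le i i' : (i <= i')%N -> (i' <= m)%N ->
    \sum_(l < i) poincare (a l) (b l) <= \sum_(l < i') poincare (a l) (b l).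
  elim: i' => [|i' IH]; first by rewrite leqn0 => /eqP->.
  rewrite leq_eqVlt => /orP[/eqP->//|ii'] im; apply: le_trans (IH ii' (ltnW im)) _.
  rewrite big_ord_recr /= lerDl; have [_ ga gb _ _] := hch i' im.
  by apply: poincare_ge0; rewrite -unit_discE.
(* The chain cut off at a point of the sphere is no longer than the whole chain, hence shorter than
   [e], whereas the sphere is at distance at least [e] from [z]. *)
have nosphere t : 0 <= t <= 1 -> ~ (chart_dom c (f j (sg t)) /\ nm (c (f j (sg t)) - c z) = rho).
  move=> t01 [dq hq]; have [h1 h2] := sg1 t t01.
  have k1 : e <= k z (f j (sg t)).
    rewrite -zz -(chart_mapK dq); apply: he; rewrite ?subrr ?nm0 ?hq //; first exact: ltW.
    by rewrite nmBC hq.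
  have k2 := kob_tri kd z (p j) (f j (sg t)).
  have k3 : k (p j) (f j (sg t)) <= poincare (a j) (sg t) by rewrite -fa; exact: kob_disc.
  have k4 := ksum j (ltnW jm).
  have := sum_le _ _ jm (leqnn m); rewrite big_ord_recr /= -sE => k5.
  lra.
suff : W (f j (sg 1)).
  by rewrite /sg rmorph1 mul1r subrKC fb.
apply: (@real_ind R (fun t => W (f j (sg t))) 0 1 ler01); last by rewrite ler01 lexx.
- by rewrite /sg rmorph0 mul0r addr0 fa.
- move=> t /andP[t0 t1] hW; have t01 : 0 <= t <= 1 by rewrite t0 ltW.
  have [d d0 hd] := sgc t W t01 (Wopen _ (hW t ltac:(by rewrite t0 lexx))).
  exists d => // u /andP[tu ud] _; apply: hd.
  by rewrite gtr0_norm; lra.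
move=> t /andP[t0 t1] hW; have t01 : 0 <= t <= 1 by rewrite t1 ltW.
apply: contrapT => nW; apply: (nosphere t t01); apply: KW => //.
apply: Kclosed => B hB; have [d d0 hd] := sgc t B t01 hB.
pose m' := Num.min d t; have m'0 : 0 < m' by rewrite lt_min d0.
have md : m' <= d by rewrite ge_min lexx.
have mt : m' <= t by rewrite ge_min lexx orbT.
exists (f j (sg (t - m' / 2))); split.
  by apply: WK; apply: hW; apply/andP; split; lra.
apply: hd; rewrite (_ : _ - t = - (m' / 2)); last by ring.
by rewrite normrN gtr0_norm; lra.
Qed.

End Barth.

(** * Contraction along integral curves *)

Section Main.
Variables (R : realType) (n : nat) (M : complexManifold R n).
Variable H : forall z : M, tangent z.
Implicit Types (z w : M) (c d : chart R n M).
Local Notation V := 'rV[R[i]]_n.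
Local Notation k := (@kobayashi R n M).
Local Notation pos := [set s : R | 0 <= s].
Hypothesis kd : is_distance k.

(** Unfolds the lower limit into the form that [dini_le] consumes. *)
Lemma dini_le0P (U : lmodType R[i]) (f : U -> R) (x v : U) : (dini f x v <= 0)%E <->
  forall e d : R, 0 < e -> 0 < d -> exists h, [/\ 0 < h, h < d & f (x + h%:C *: v) <= f x + e * h].
Proof.
rewrite /dini limf_einfE; split.
  move=> hs e d e0 d0; apply: contrapT => nex.
  suff : (e%:E <= 0)%E by rewrite lee_fin leNgt e0.
  have hB : (0 : R)^'+ [set h | 0 < h < d].
    apply/nbhs_real; exists d => // h; rewrite subr0 => hd /= h0.
    by rewrite h0 (le_lt_trans (ler_norm h)).
  apply: le_trans (le_trans _ hs); last by apply: ereal_sup_ubound; exists [set h | 0 < h < d].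
  apply: le_ereal_inf_tmp => _ [h /= /andP[h0 hd] <-].
  rewrite lee_fin ler_pdivlMr // lerBrDl leNgt; apply/negP => hlt.
  by apply: nex; exists h; split=> //; exact: ltW.
move=> hex; apply: ge_ereal_sup => _ [B hB <-].
apply/lee_addgt0Pr => e e0; rewrite add0e.
have /nbhs_real[d d0 hd] : nbhs (0 : R) (fun h => 0 < h -> B h) by exact: hB.
have [h [h0 hlt hf]] := hex e d e0 d0.
have Bh : B h by apply: hd => //; rewrite subr0 gtr0_norm.
apply: le_trans (ereal_inf_lbound _) _; first by exists h.
by rewrite lee_fin ler_pdivrMr // lerBlDl.
Qed.

Definition dini_nonpos := forall z w, z <> w ->
    forall c d, chart_at z c -> chart_at w d ->
      (dini_in_charts k c d (H z) (H w) <= 0)%E.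

(* In the charts, a curve through [z] with velocity [v] may be replaced by   *)
(* its tangent line, since [k] is Lipschitz there.                           *)
Lemma kob_tangent (A : set R) (g1 g2 : R -> M) (t : R) z w (u : tangent z) (v : tangent w) c d :
  derivative_within A g1 t u -> derivative_within A g2 t v ->
  chart_at z c -> chart_at w d -> forall e : R, 0 < e -> exists2 r : R, 0 < r &
  forall h, 0 < h -> h < r -> A (t + h) ->
    `|k (g1 (t + h)) (g2 (t + h)) -
      k (chart_inv c (c z + h%:C *: u c)) (chart_inv d (d w + h%:C *: v d))| <= e * h.
Proof.
move=> h1 h2 cz dw e e0.
have half : forall (g : R -> M) z (u : tangent z) c, derivative_within A g t u -> chart_at z c ->
    exists2 r : R, 0 < r & forall h, 0 < h -> h < r -> A (t + h) ->
    k (g (t + h)) (chart_inv c (c z + h%:C *: u c)) <= e / 2 * h.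
  clear h1 h2 cz dw; move=> g z1 u1 c1 hg cz.
  have [r [C [r0 C0 [hr kL]]]] := kob_lip kd cz.
  have C1 : 0 < 2 * (C + 1) by lra.
  have eC : 0 < e / (2 * (C + 1)) by rewrite divr_gt0.
  have [d1 d10 hd1] := derivative_withinP hg cz eC.
  have [d2 d20 hd2] := derivative_withinP hg cz ltr01.
  have un1 : 0 < nm (u1 c1) + 1 by rewrite ltr_wpDl ?nm_ge0.
  exists (Num.min (Num.min d1 d2) (r / (nm (u1 c1) + 1))) => [|h h0].
    by rewrite !lt_min d10 d20 divr_gt0.
  rewrite !lt_min ltr_pdivlMr // => /andP[/andP[hl1 hl2] hr'] Ath.
  have tE : t + h - t = h by ring.
  have tn : t + h != t by rewrite -subr_eq0 tE gt_eqF.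
  have := hd1 (t + h) Ath; rewrite tE gtr0_norm // => /(_ hl1 tn)[dm k1].
  have := hd2 (t + h) Ath; rewrite tE gtr0_norm // => /(_ hl2 tn)[_ k2].
  rewrite -{1}(chart_mapK dm).
  have nu : nm (h%:C *: u1 c1) = h * nm (u1 c1) by rewrite nmZr gtr0_norm.
  have hr2 : h * nm (u1 c1) < r by move: hr'; rewrite mulrDr; lra.
  have hx : nm (c1 z1 + h%:C *: u1 c1 - c1 z1) < r by rewrite addrC addKr nu.
  have hg' : nm (c1 (g (t + h)) - c1 z1) < r.
    have := nmB_le (c1 (g (t + h)) - c1 z1) (h%:C *: u1 c1); rewrite nu.
    by move: hr'; rewrite mulrDr; lra.
  apply: le_trans (kL _ _ hg' hx) _.
  rewrite opprD addrA.
  apply: le_trans (_ : C * (e / (2 * (C + 1)) * h) <= _); first by rewrite ler_wpM2l.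
  apply: le_trans (_ : (C + 1) * (e / (2 * (C + 1)) * h) <= _).
    by rewrite ler_wpM2r ?lerDl // mulr_ge0 // ltW.
  rewrite le_eqVlt; apply/orP; left; apply/eqP; field; lra.
have [r1 r10 k1] := half _ _ _ _ h1 cz; have [r2 r20 k2] := half _ _ _ _ h2 dw.
exists (Num.min r1 r2) => [|h h0]; first by rewrite lt_min r10.
rewrite lt_min => /andP[hr1 hr2] Ath.
have {}k1 := k1 h h0 hr1 Ath; have {}k2 := k2 h h0 hr2 Ath.
set x := g1 (t + h) in k1 *; set y := g2 (t + h) in k2 *.
set x' := chart_inv c _ in k1 *; set y' := chart_inv d _ in k2 *.
have := kob_tri kd x x' y; have := kob_tri kd x' y' y.
have := kob_tri kd x' x y'; have := kob_tri kd x y y'.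
rewrite (kob_sym kd x' x) (kob_sym kd y' y) => *.
by rewrite ler_norml; apply/andP; split; lra.
Qed.

Lemma contraction_dini_nonpos (e : R) (f : R -> M -> M) : 0 < e ->
  (forall t, 0 <= t < e -> holomorphic (f t)) ->
  (forall z : M, f 0 z = z /\
     derivative_within [set t | 0 <= t < e] (fun t => f t z) 0 (H z)) ->
  dini_nonpos.
Proof.
move=> e0 fh fd z w zw c d cz dw; apply/dini_le0P => eps r eps0 r0.
have [_ d1] := fd z; have [_ d2] := fd w.
have [r1 r10 hr1] := kob_tangent d1 d2 cz dw eps0.
pose h := Num.min (Num.min r1 r) e / 2.
have m0 : 0 < Num.min (Num.min r1 r) e by rewrite !lt_min r10 r0.
have m1 : Num.min (Num.min r1 r) e <= r1 by rewrite !ge_min lexx.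
have m2 : Num.min (Num.min r1 r) e <= r by rewrite !ge_min lexx orbT.
have m3 : Num.min (Num.min r1 r) e <= e by rewrite !ge_min lexx !orbT.
have h0 : 0 < h by rewrite divr_gt0.
have he : 0 <= h < e by rewrite ltW //= /h; lra.
exists h; split=> //; first by rewrite /h; lra.
have := hr1 h h0 ltac:(by rewrite /h; lra); rewrite add0r => /(_ he) /=.
rewrite !chart_mapK; [|exact: (proj2 dw)|exact: (proj2 cz)].
have := kob_contract kd z w (fh h he).
by rewrite ler_norml => kc /andP[? ?]; lra.
Qed.

Hypothesis hb : dini_nonpos.

Lemma dini_step g1 g2 T t : solves H g1 T -> solves H g2 T -> 0 <= t < T ->
  g1 t <> g2 t -> forall e d : R, 0 < e -> 0 < d -> exists h, [/\ 0 < h, h < d &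
    k (g1 (t + h)) (g2 (t + h)) <= k (g1 t) (g2 t) + e * h].
Proof.
move=> s1 s2 tT ne e d e0 d0.
have [c cz] := exists_chart (g1 t); have [c' cw] := exists_chart (g2 t).
have e2 : 0 < e / 2 by rewrite divr_gt0.
have [r r0 hr] := kob_tangent (s1 t tT) (s2 t tT) cz cw e2.
have /dini_le0P hd := hb ne cz cw.
have [h [h0 hm hk]] := hd (e / 2) (Num.min d r) e2 ltac:(by rewrite lt_min d0).
move: hm; rewrite lt_min => /andP[h1 h2]; exists h; split=> //.
move/andP: tT => [t0 _].
have := hr h h0 h2 ltac:(by rewrite /= addr_ge0 // ltW).
move: hk; rewrite /= !chart_mapK; [|exact: (proj2 cw)|exact: (proj2 cz)].
rewrite ler_norml => hk /andP[_ hk']; lra.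
Qed.

(** Nothing is assumed where the curves meet. For [m] above the initial distance, consider the
    maximum of the distance and [m]: while the distance is below [m], continuity keeps the maximum
    equal to [m] for a short time, and otherwise the points are distinct and a Dini step is
    available. Then [m] tends to the initial distance. *)
Lemma kob_nonincreasing g1 g2 T s t : solves H g1 T -> solves H g2 T ->
  0 <= s -> s <= t -> t < T -> k (g1 t) (g2 t) <= k (g1 s) (g2 s).
Proof.
move=> s1 s2 s0 st tT.
have cont u : 0 <= u < T -> forall e : R, 0 < e -> exists2 d : R, 0 < d &
    forall v, 0 <= v -> `|v - u| < d -> `|k (g1 v) (g2 v) - k (g1 u) (g2 u)| <= e.
  move=> uT e e0; have e2 : 0 < e / 2 by rewrite divr_gt0.
  have [d1 d10 h1] := flows_cont (s1 u uT) (kob_small kd (g1 u) e2).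
  have [d2 d20 h2] := flows_cont (s2 u uT) (kob_small kd (g2 u) e2).
  exists (Num.min d1 d2) => [|v v0]; first by rewrite lt_min d10.
  rewrite lt_min => /andP[v1 v2]; have {}h1 := h1 v v0 v1; have {}h2 := h2 v v0 v2.
  rewrite /= in h1 h2.
  have := kob_tri kd (g1 u) (g1 v) (g2 u); have := kob_tri kd (g1 v) (g2 v) (g2 u).
  have := kob_tri kd (g1 v) (g1 u) (g2 v); have := kob_tri kd (g1 u) (g2 u) (g2 v).
  rewrite (kob_sym kd (g1 v) (g1 u)) (kob_sym kd (g2 v) (g2 u)) => *.
  by rewrite ler_norml; apply/andP; split; lra.
suff hm (m : R) : k (g1 s) (g2 s) < m -> k (g1 t) (g2 t) <= m.
  rewrite leNgt; apply/negP => lt.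
  by have := hm ((k (g1 s) (g2 s) + k (g1 t) (g2 t)) / 2) ltac:(lra); lra.
move=> ms; pose phi u := Num.max (k (g1 u) (g2 u)) m.
have m0 : 0 < m by apply: le_lt_trans ms; exact: kob_ge0.
have ps : phi s = m by rewrite /phi max_r // ltW.
have le1 u : k (g1 u) (g2 u) <= phi u by rewrite le_max lexx.
have le2 u : m <= phi u by rewrite le_max lexx orbT.
have phile u q : k (g1 u) (g2 u) <= q -> m <= q -> phi u <= q.
  by move=> ? ?; rewrite /phi ge_max; apply/andP.
suff : phi t <= phi s by rewrite ps; exact: le_trans (le1 t).
apply: dini_le => // [u /andP[su ut] e e0|u /andP[su ut] e d e0 d0].
  have [d d0 hd] := cont u ltac:(apply/andP; split; lra) e e0.
  exists d => // v /andP[sv vu] uv.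
  have := hd v ltac:(lra) ltac:(by rewrite distrC ger0_norm; lra).
  rewrite ler_norml => /andP[q1 _].
  by apply: phile; have := le1 v; have := le2 v; lra.
have uT : 0 <= u < T by apply/andP; split; lra.
have [klt|kge] := ltP (k (g1 u) (g2 u)) m.
  have [d' d'0 hd'] := cont u uT (m - k (g1 u) (g2 u)) ltac:(by rewrite subr_gt0).
  pose h := Num.min (Num.min d d') (t - u) / 2.
  have q0 : 0 < Num.min (Num.min d d') (t - u) by rewrite !lt_min d0 d'0 subr_gt0.
  have q1 : Num.min (Num.min d d') (t - u) <= d by rewrite !ge_min lexx.
  have q2 : Num.min (Num.min d d') (t - u) <= d' by rewrite !ge_min lexx orbT.
  have q3 : Num.min (Num.min d d') (t - u) <= t - u by rewrite !ge_min lexx orbT.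
  have h0 : 0 < h by rewrite divr_gt0.
  have eh : 0 < e * h by rewrite mulr_gt0.
  exists h; split=> //; try by rewrite /h; lra.
  have := hd' (u + h) ltac:(lra); rewrite (_ : u + h - u = h); last by ring.
  rewrite gtr0_norm // => /(_ ltac:(by rewrite /h; lra)); rewrite ler_norml => /andP[_ q4].
  by apply: phile; have := le2 u; lra.
have ne : g1 u <> g2 u by move=> E; move: kge; rewrite E (kob_refl kd); lra.
have [h [h0 hd hk]] := dini_step s1 s2 uT ne e0
  (ltac:(by rewrite lt_min d0 subr_gt0) : 0 < Num.min d (t - u)).
move: hd; rewrite lt_min => /andP[hd1 hd2].
have eh : 0 < e * h by rewrite mulr_gt0.
exists h; split=> //; first lra.
by apply: phile; have := le1 u; have := le2 u; lra.
Qed.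

End Main.

(** * Global integral curves and their semigroup *)

Section Generator.
Variables (R : realType) (n : nat) (M : complexManifold R n).
Variable H : forall z : M, tangent z.
Implicit Types (z w : M) (c d : chart R n M).
Local Notation k := (@kobayashi R n M).
Hypothesis hH : holomorphic_vector_field H.
Hypothesis kd : is_distance k.

Lemma dini_nonpos_generator : is_complete k -> dini_nonpos H -> infinitesimal_generator H.
Proof.
move=> kc hb z0.
suff all T : exists g, g 0 = z0 /\ solves H g T.
  have [G [G0 hG]] := solves_glue hH kd z0; exists G; split=> // t t0.
  have [g [g0 gT]] := all (t + 1).
  by apply: hG => //; exists g, (t + 1); split=> //; rewrite ltrDl.
(* If some [T] is not reached, the times of existence are bounded, and their supremum [T1] is to be
   exceeded. *)
apply: contrapT => nT.
pose S : set R := [set T | exists g, g 0 = z0 /\ solves H g T].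
have ubS : ubound S T.
  move=> T' [g [g0 gT']]; rewrite leNgt; apply/negP => lt; apply: nT.
  by exists g; split=> //; apply: solves_le gT'; exact: ltW.
have [U [tau [Y [nU tau0 hY]]]] := local_flow hH kd z0.
have Stau : S tau.
  by have [Y0 sY _] := hY z0 (nbhs_singleton nU); exists (Y ^~ z0).
pose T1 := sup S.
have tT1 : tau <= T1 by apply: ub_le_sup => //; exists T.
have T10 : 0 < T1 by exact: lt_le_trans tT1.
have [G [G0 hG]] := solves_glue hH kd z0.
have GT : solves H G T1.
  move=> t /andP[t0 tT]; apply: hG => //.
  have [T' [g [g0 gT']] tT'] := sup_gt (ex_intro _ tau Stau) tT.
  by exists g, T'.
have contr t s : 0 <= t -> 0 <= s -> t + s < T1 -> k (G t) (G (t + s)) <= k (G 0) (G s).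
  move=> t0 s0 ts; have h1 := solves_shift s0 GT.
  have h2 : solves H G (T1 - s) by apply: solves_le GT; lra.
  have := kob_nonincreasing kd hb h2 h1 (lexx 0) t0 ltac:(lra).
  by rewrite addr0 [s + t]addrC.
(* These times increase to [T1], with [T1 / i.+1] left to go. *)
pose ti (i : nat) := T1 - T1 / i.+1%:R.
have i0 (i : nat) : 0 < i.+1%:R :> R by rewrite ltr0n.
have tib i : 0 <= ti i < T1.
  rewrite subr_ge0 gtrBl divr_gt0 // andbT ler_pdivrMr //.
  by rewrite ler_peMr ?ler1n // ltW.
have cauchy e : 0 < e -> exists N : nat, forall i j : nat,
    (N <= i)%N -> (N <= j)%N -> k (G (ti i)) (G (ti j)) < e.
  move=> e0; have [d d0 hd] := flows_cont (GT 0 ltac:(by rewrite lexx)) (kob_small kd (G 0) e0).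
  have [N hN] := inv_nat_small (ltW T10) d0; exists N.
  have key i j : (N <= i)%N -> ti i <= ti j -> k (G (ti i)) (G (ti j)) < e.
    move=> Ni tij; move/andP: (tib i) => [ti0 _]; move/andP: (tib j) => [tj0 tj1].
    have := contr (ti i) (ti j - ti i) ti0 ltac:(by rewrite subr_ge0); rewrite subrKC => /(_ tj1) h.
    apply: le_lt_trans h _; apply: hd; first by rewrite subr_ge0.
    rewrite subr0 ger0_norm ?subr_ge0 //; apply: le_lt_trans (hN i Ni).
    apply: le_trans (_ : T1 - ti i <= _); first by rewrite lerD2r ltW.
    by rewrite /ti subKr.
  move=> i j Ni Nj; have [tij|tji] := leP (ti i) (ti j); first exact: key.
  by rewrite (kob_sym kd); apply: key => //; exact: ltW.
have [l hl] := kc (fun i => G (ti i)) cauchy.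
have [U2 [tau2 [Y2 [nU2 tau20 hY2]]]] := local_flow hH kd l.
have [e e0 he] := kob_topology kd nU2.
have [N1 _ hN1] : \forall i \near \oo, `|k (G (ti i)) l - 0| < e.
  apply: (hl [set x | `|x - 0| < e]).
  by apply/nbhs_real; exists e.
(* From index [N2] on, the remaining time is less than the duration [tau2] of the local flow near
   the limit [l], so a curve restarted there passes [T1]. *)
have [N2 hN2] := inv_nat_small (ltW T10) tau20.
pose i := maxn N1 N2.
have ki : k (G (ti i)) l < e.
  have := hN1 i (leq_maxl _ _); rewrite /= subr0 => h.
  exact: le_lt_trans (ler_norm _) h.
have Ui : U2 (G (ti i)) by apply: he; rewrite (kob_sym kd).
have [Y20 sY2 _] := hY2 _ Ui.
have [G' [G'0 hG']] := solves_concat hH kd GT sY2 (tib i) Y20.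
have : ti i + tau2 <= T1.
  by apply: ub_le_sup; [exists T|exists G'; split=> //; rewrite G'0].
have := hN2 i (leq_maxr _ _); rewrite /ti; set q := T1 / _; lra.
Qed.

Lemma cdiff_near (W : normedModType R[i]) (f g : W -> M) (a : W) :
  (\forall x \near a, f x = g x) -> cdiff_at f a -> cdiff_at g a.
Proof.
move=> fg [fc fd]; have fga : f a = g a := nbhs_singleton fg.
split.
  move=> A hA; have fA : nbhs a (fun x => A (f x)) by apply: (nbhs_preim fc); rewrite fga.
  suff : nbhs a (fun x => A (g x)) by [].
  by apply: nbhsS (filterI fg fA) => x [<-].
move=> c cga; apply: (proj1 (diff_near (fd c _) _)); first by rewrite fga.
by apply: nbhsS fg => x /= ->.
Qed.

Lemma holo_at_near (f g : M -> M) z :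
  (\forall w \near z, f w = g w) -> holo_at f z -> holo_at g z.
Proof.
move=> fg fh c cz; apply: cdiff_near (fh c cz).
apply: (@nbhs_preim _ _ (chart_inv c) (c z) (fun w => f w = g w)).
  by apply: chart_inv_cont; exact: (proj2 cz).
by rewrite chart_mapK //; exact: (proj2 cz).
Qed.

Lemma holo_at_comp (f g : M -> M) z : holo_at f z -> holo_at g (f z) -> holo_at (g \o f) z.
Proof.
move=> fh gh c cz; apply: (cdiff_comp (fh c cz)).
by rewrite /= chart_mapK //; exact: (proj2 cz).
Qed.

(** By the semigroup law, the map at a later time is the map at an earlier one followed by a short
    flow near the orbit. For the passage to a time [s] from the left, the earlier time is taken so
    close to [s] that the orbit is already in the neighbourhood of [g z s] on which the short flow
    is holomorphic. *)
Lemma flow_holomorphic (g : M -> R -> M) : (forall z, g z 0 = z) ->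
  (forall z t, 0 <= t -> flows_at H (g z) t) ->
  forall t, 0 <= t -> holomorphic (fun z => g z t).
Proof.
move=> g0 gf t t0 z.
have gT (z1 : M) T : solves H (g z1) T by move=> s /andP[s0 _]; exact: gf.
have semi (z1 : M) s u : 0 <= s -> 0 <= u -> g z1 (s + u) = g (g z1 s) u.
  move=> s0 u0.
  apply: (@solves_unique _ _ _ H hH kd (fun u => g z1 (s + u)) (g (g z1 s)) (u + 1)) => //.
  - by have := solves_shift s0 (gT z1 (s + (u + 1))); rewrite addrC addKr.
  - by rewrite addr0 g0.
  - by rewrite u0 ltrDl /=.
have loc (p : M) : exists2 U : set M, nbhs p U & exists2 tau : R, 0 < tau & forall q s, U q ->
    0 <= s < tau -> holo_at (g ^~ s) q.
  have [U [tau [Y [nU tau0 hY]]]] := local_flow hH kd p.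
  (* Holomorphy at [q] is transferred through agreement near [q], so [U] has to be a neighbourhood
     of [q]. *)
  exists (interior U); first exact: nbhs_interior.
  exists tau => // q s Uq st; have [_ _ Yh] := hY q (nbhs_singleton Uq).
  apply: holo_at_near (Yh s st); apply: nbhsS Uq => w Uw.
  have [Y0 sY _] := hY w Uw.
  by apply: (@solves_unique _ _ _ H hH kd (Y ^~ w) (g w) tau) => //; rewrite Y0 g0.
suff : holo_at (g ^~ t) z by [].
apply: (@real_ind R (fun s => holo_at (g ^~ s) z) 0 t t0); last by rewrite t0 lexx.
- have [U nU [tau tau0 hU]] := loc z.
  by apply: hU; [exact: nbhs_singleton nU|rewrite lexx].
- move=> s /andP[s0 st] hs; have [U nU [tau tau0 hU]] := loc (g z s).
  exists tau => // u /andP[su us] _.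
  have h1 : holo_at ((g ^~ (u - s)) \o (g ^~ s)) z.
    apply: holo_at_comp; first by apply: hs; rewrite s0 lexx.
    by apply: hU; [exact: nbhs_singleton nU|apply/andP; split; lra].
  apply: holo_at_near h1; apply: nearW => w /=.
  by rewrite -semi ?subrKC // subr_ge0 ltW.
move=> s /andP[s0 st] hs; have [U nU [tau tau0 hU]] := loc (g z s).
have [d d0 hd] := flows_cont (gf z s (ltW s0)) nU.
pose m := Num.min (Num.min d tau) s.
have m0 : 0 < m by rewrite !lt_min d0 tau0.
have m1 : m <= d by rewrite !ge_min lexx.
have m2 : m <= tau by rewrite !ge_min lexx orbT.
have m3 : m <= s by rewrite !ge_min lexx orbT.
pose u := s - m / 2; have su : s - u = m / 2 by rewrite /u; ring.
have u0 : 0 <= u by rewrite /u; lra.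
have h1 : holo_at ((g ^~ (s - u)) \o (g ^~ u)) z.
  apply: holo_at_comp; first by apply: hs; apply/andP; split=> //; rewrite /u; lra.
  apply: hU; last by rewrite su; apply/andP; split; lra.
  by apply: hd => //; rewrite distrC su gtr0_norm; lra.
apply: holo_at_near h1; apply: nearW => w /=.
by rewrite -semi ?subrKC // su divr_ge0 // ltW.
Qed.

Lemma generator_semigroup : infinitesimal_generator H ->
  exists (e : R) (f : R -> M -> M),
    [/\ 0 < e,
        (forall t, 0 <= t < e -> holomorphic (f t))
      & (forall z : M, f 0 z = z /\
           derivative_within [set t | 0 <= t < e] (fun t => f t z) 0 (H z))].
Proof.
move=> /choice[g hg].
have g0 z : g z 0 = z by have [] := hg z.
have gf z t : 0 <= t -> flows_at H (g z) t by have [_] := hg z; apply.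
(* The curves exist for all times, so any length of the time interval will do. *)
exists 1, (fun t z => g z t); split=> //.
  by move=> t /andP[t0 _]; exact: flow_holomorphic.
move=> z; split=> //; have [c cz] := exists_chart z.
apply: (derivative_within_chart cz) => e e0.
have cz' : chart_at (g z 0) c by rewrite g0.
have [d d0 hd] := flows_chart (gf z 0 (lexx 0)) cz' e0.
exists d => // s /andP[s0 _] sd _; have := hd s s0 sd.
by rewrite g0.
Qed.

End Generator.

Theorem theorem1p1 (R : realType) (n : nat) (M : complexManifold R n)
    (H : forall z : M, tangent z)
    (hM : complete_hyperbolic M) (hH : holomorphic_vector_field H) :
  let a := exists (e : R) (f : R -> M -> M),
    [/\ 0 < e,
        (forall t, 0 <= t < e -> holomorphic (f t))
      & (forall z : M, f 0 z = z /\
           derivative_within [set t | 0 <= t < e] (fun t => f t z) 0 (H z))] in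
  let b := forall z w : M, z <> w ->
    forall c d, chart_at z c -> chart_at w d ->
      (dini_in_charts (@kobayashi R n M) c d (H z) (H w) <= 0)%E in
  let c := infinitesimal_generator H in
  (a <-> b) /\ (b <-> c).
Proof.
have [kd kc] := hM; move=> a b c.
have ab : a -> b by move=> [e [f [e0 fh fd]]]; exact: contraction_dini_nonpos e0 fh fd.
have bc : b -> c by exact: dini_nonpos_generator.
have ca : c -> a by exact: generator_semigroup.
by split; split; [|move/bc/ca| |move/ca/ab].
Qed.
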